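(* Let $N\in\{2,3\}$ and let $\Omega=\{x\in\mathbb{R}^N: |x|<1\}$ be the unit ball. Let $\mathbf{n}$ and $\sigma$ be positive constants satisfying $\mathbf{n}^2>\sigma$. Then for any given $\tau\in(0,1)$ there exists a sequence of pairs of transmission eigenfunctions $\{(u_m,v_m)\}_{m\in\mathbb{N}}$ associated with transmission eigenvalues $k_m$ satisfying $k_m\to\infty$ as $m\to\infty$, such that both $$\lim_{m\to\infty}\frac{\|u_m\|_{L^2(\Omega_\tau)}}{\|u_m\|_{L^2(\Omega)}}=0\qquad\text{and}\qquad \lim_{m\to\infty}\frac{\|v_m\|_{L^2(\Omega_\tau)}}{\|v_m\|_{L^2(\Omega)}}=0,$$ where $\Omega_\tau=\{x\in\mathbb{R}^N:|x|<\tau\}$.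
   Context: A number $k\in\mathbb{R}_+$ is a transmission eigenvalue, with associated pair of transmission eigenfunctions $(u,v)\in H^1(\Omega)\times H^1(\Omega)$, if $(u,v)$ is a nontrivial solution (not $u=v\equiv 0$) of $$\nabla\cdot(\sigma\nabla u)+k^2\mathbf{n}^2u=0\ \text{ in }\Omega,\qquad \Delta v+k^2v=0\ \text{ in }\Omega,\qquad u=v,\ \ \sigma\frac{\partial u}{\partial\nu}=\frac{\partial v}{\partial\nu}\ \text{ on }\partial\Omega,$$ where $\nu$ is the exterior unit normal to $\partial\Omega$. *)

(* Defs.v *)
From HB Require Import structures.
From mathcomp Require Import all_boot all_order all_algebra.
From mathcomp Require Import all_classical all_reals all_analysis.

Set Implicit Arguments.
Unset Strict Implicit.
Unset Printing Implicit Defensive.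
Import Order.TTheory GRing.Theory Num.Theory.
Import numFieldNormedType.Exports.

Local Open Scope classical_set_scope.
Local Open Scope ring_scope.

Section measurable_rV.
Context {R : realType} (n : nat).

Let coors : 'I_n -> 'rV[R]_n -> R := fun i x => x ord0 i.

Let rV_set0 : g_sigma_preimage coors set0.
Proof. exact: sigma_algebra0. Qed.

Let rV_setC A : g_sigma_preimage coors A -> g_sigma_preimage coors (~` A).
Proof. exact: sigma_algebraC. Qed.

Let rV_bigcup (F : _^nat) : (forall i, g_sigma_preimage coors (F i)) ->
  g_sigma_preimage coors (\bigcup_i (F i)).
Proof. exact: sigma_algebra_bigcup. Qed.

(* The sigma-algebra generated by the coordinates, i.e. the Borel sets. *)
HB.instance Definition _ :=
  @isMeasurable.Build (measure_tuple_display default_measure_display)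
    'rV[R]_n (g_sigma_preimage coors) rV_set0 rV_setC rV_bigcup.

Lemma measurable_coord (i : 'I_n) :
  measurable_fun [set: 'rV[R]_n] (fun x : 'rV[R]_n => x ord0 i).
Proof.
move=> _ Y mY; rewrite setTI; apply: sub_sigma_algebra => /=.
rewrite -bigcup_seq/=; exists i => /=; first by rewrite mem_index_enum.
by exists Y => //; rewrite setTI.
Qed.

Lemma measurable_fun_rV d (T : measurableType d) (f : T -> 'rV[R]_n) :
  (forall i, measurable_fun [set: T] (fun t => f t ord0 i)) ->
  measurable_fun [set: T] f.
Proof.
move=> mf.
suff h : g_sigma_preimage (fun i => coors i \o f) `<=` measurable.
  move=> _ A mA; apply: h; rewrite g_sigma_preimage_comp; exists A => //.
apply: smallest_sub; first exact: sigma_algebra_measurable.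
case: n @coors f mf => [|m] c f mf; first by rewrite big_ord0.
rewrite -bigcup_mkord_ord; apply: bigcup_sub => i Ii.
by move=> A [B mB <-]; exact: mf.
Qed.

End measurable_rV.

Section rV_cons.
Context {R : realType} (n : nat).

Definition rV_cons (p : measurableTypeR R * 'rV[R]_n) : 'rV[R]_n.+1 :=
  row_mx (p.1)%:M p.2.

Definition rV_uncons (x : 'rV[R]_n.+1) : measurableTypeR R * 'rV[R]_n :=
  (x ord0 ord0, @rsubmx R 1 1 n x).

Lemma rV_consK : cancel rV_cons rV_uncons.
Proof.
move=> [a y]; rewrite /rV_cons /rV_uncons /= row_mxKr; congr pair.
have -> : (ord0 : 'I_n.+1) = lshift n (ord0 : 'I_1) by exact/val_inj.
by apply: etrans (row_mxEl _ _ _ _) _; rewrite mxE.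
Qed.

Lemma measurable_rV_cons : measurable_fun setT rV_cons.
Proof.
apply: measurable_fun_rV => i.
case: (split_ordP (i : 'I_(1 + n))) => j ->.
- rewrite (_ : (fun t => _) = fst); first exact: measurable_fst.
  by apply/funext => t; apply: etrans (row_mxEl _ _ _ _) _; rewrite mxE !ord1.
- rewrite (_ : (fun t => _) = (fun y : 'rV[R]_n => y ord0 j) \o snd).
    apply: measurableT_comp; first exact: measurable_coord.
    exact: measurable_snd.
  by apply/funext => t; exact: row_mxEr.
Qed.

Lemma measurable_rV_uncons : measurable_fun setT rV_uncons.
Proof.
apply: measurable_fun_pair; first exact: measurable_coord.
apply: measurable_fun_rV => i.
rewrite (_ : (fun t => _) = fun t : 'rV[R]_n.+1 => t ord0 (rshift 1 i)).
  exact: measurable_coord.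
by apply/funext => t; rewrite mxE.
Qed.

Variable mu : {sigma_finite_measure set 'rV[R]_n -> \bar R}.

Definition lebesgue_cons : set 'rV[R]_n.+1 -> \bar R :=
  pushforward (@lebesgue_measure R \x mu)%E rV_cons.

Let lebesgue_cons0 : lebesgue_cons set0 = 0%E.
Proof. by rewrite /lebesgue_cons /pushforward preimage_set0 measure0. Qed.

Let lebesgue_cons_ge0 A : (0 <= lebesgue_cons A)%E.
Proof. by rewrite /lebesgue_cons /pushforward measure_ge0. Qed.

Let measurable_preimage_cons A :
  measurable A -> measurable (rV_cons @^-1` A).
Proof.
by move=> mA; rewrite -[X in measurable X]setTI; exact: measurable_rV_cons.
Qed.

Let lebesgue_cons_sigma_additive : semi_sigma_additive lebesgue_cons.
Proof.
move=> F mF tF mUF; rewrite /lebesgue_cons /pushforward preimage_bigcup.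
apply: measure_semi_sigma_additive.
- by move=> k; exact: measurable_preimage_cons.
- apply/trivIsetP => /= i j _ _ ij; rewrite -preimage_setI.
  by move/trivIsetP : tF => /(_ _ _ _ _ ij) ->//; rewrite preimage_set0.
- by rewrite -preimage_bigcup; exact: measurable_preimage_cons.
Qed.

HB.instance Definition _ := isMeasure.Build _ _ _ lebesgue_cons
  lebesgue_cons0 lebesgue_cons_ge0 lebesgue_cons_sigma_additive.

Let lebesgue_cons_sigma_finite : sigma_finite setT lebesgue_cons.
Proof.
have [F TF Foo] : sigma_finite setT (@lebesgue_measure R \x mu)%E.
  have /sigma_finiteP[F [TF ndF Foo]] := sigma_finiteT (@lebesgue_measure R).
  have /sigma_finiteP[G [TG ndG Goo]] := sigma_finiteT mu.
  exists (fun k => F k `*` G k).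
    rewrite -setXTT TF TG predeqE => -[x y]; split.
      move=> [/= [i _ Fix] [j _ Gjy]]; exists (maxn i j) => //; split.
      - by move: x Fix; exact/subsetPset/ndF/leq_maxl.
      - by move: y Gjy; exact/subsetPset/ndG/leq_maxr.
    by move=> [i _ []/= ? ?]; split; exists i.
  move=> k; have [? ?] := Foo k; have [? ?] := Goo k.
  split; first exact: measurableX.
  by rewrite product_measure1E// lte_mul_pinfty// ge0_fin_numE.
exists (fun k => rV_uncons @^-1` F k).
  by rewrite -preimage_bigcup -TF preimage_setT.
move=> k; have [mFk Fkoo] := Foo k; split.
  by rewrite -[X in measurable X]setTI; exact: measurable_rV_uncons.
rewrite /lebesgue_cons /pushforward -comp_preimage.
rewrite (_ : rV_uncons \o rV_cons = id) ?preimage_id//.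
by apply/funext => p; exact: rV_consK.
Qed.

HB.instance Definition _ := Measure_isSigmaFinite.Build _ _ _ lebesgue_cons
  lebesgue_cons_sigma_finite.

End rV_cons.
Arguments rV_cons {R n}.
Arguments rV_uncons {R n}.

(* [lebesgue_rV N] is the N-fold product of the Lebesgue measure on R; the
   space of dimension 0 is a single point, of mass 1. *)
Fixpoint lebesgue_rV (R : realType) (N : nat) :
    {sigma_finite_measure set 'rV[R]_N -> \bar R} :=
  match N with
  | 0 => \d_(0 : 'rV[R]_0)
  | N'.+1 => lebesgue_cons (lebesgue_rV R N')
  end.
Arguments lebesgue_rV {R N}.

Section function_spaces.
Context {R : realType} {N : nat}.
Local Notation V := 'rV[R]_N.
Implicit Types (U : set V) (f g u : V -> R) (G F : V -> V).

(* The canonical norm of ['rV[R]_N] is the sup norm; balls and the unit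
   sphere are taken for the Euclidean one. *)
Definition enorm (x : V) : R := Num.sqrt (\sum_i x ord0 i ^+ 2).

Definition eball (r : R) : set V := [set x | enorm x < r].

Definition L2 U f : Prop := f \_ U \in Lfun lebesgue_rV 2%:E.

Definition L2norm U f : \bar R := ('N[lebesgue_rV]_2%:E [EFin \o (f \_ U)])%E.

Definition pderive (i : 'I_N) f : V -> R := fun x => 'D_(delta_mx ord0 i) f x.

Fixpoint Cr (r : nat) f : Prop :=
  match r with
  | 0 => continuous f
  | r'.+1 => [/\ continuous f,
      forall i x, derivable f x (delta_mx ord0 i) &
      forall i, Cr r' (pderive i f)]
  end.

Definition smooth f : Prop := forall r, Cr r f.

(* C_c^oo(U), each function being extended by 0 outside U. *)
Definition test_function U f : Prop :=
  smooth f /\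
  exists K, [/\ compact K, K `<=` U & forall x, ~ K x -> f x = 0].

Definition dotV (x y : V) : R := \sum_i x ord0 i * y ord0 i.

Definition grad f : V -> V := fun x => \row_i pderive i f x.

(* [H1 U u G] : u belongs to H^1(U) and its weak gradient is G. *)
Definition H1 U u G : Prop :=
  [/\ L2 U u, forall i, L2 U (fun x => G x ord0 i) &
    forall i phi, test_function U phi ->
      \int[lebesgue_rV]_(x in U) (u x * pderive i phi x)
      = - \int[lebesgue_rV]_(x in U) (G x ord0 i * phi x)].

(* div F = f in U, in the sense of distributions. *)
Definition weak_div U F f : Prop :=
  forall phi, test_function U phi ->
    \int[lebesgue_rV]_(x in U) dotV (F x) (grad phi x)
    = - \int[lebesgue_rV]_(x in U) (f x * phi x).

(* For F in L^2(U)^N with f := div F in L^2(U), the normal trace of F is the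
   element of H^(-1/2)(bd U) defined by Green's formula
     <F . nu, phi> = int_U (F . grad phi + (div F) phi),   phi in H^1(U). *)
Definition normal_trace U F f (phi : V -> R) (Gphi : V -> V) : R :=
  \int[lebesgue_rV]_(x in U) (dotV (F x) (Gphi x) + f x * phi x).

(* F1 . nu = F2 . nu on the boundary of U, where fi = div Fi. *)
Definition eq_normal_trace U F1 f1 F2 f2 : Prop :=
  forall phi Gphi, H1 U phi Gphi ->
    normal_trace U F1 f1 phi Gphi = normal_trace U F2 f2 phi Gphi.

(* The surface measure s of the unit sphere S is given by polar coordinates:
     int_S g ds = N * int_{|x| < 1} g(x / |x|) dx. *)
Definition radial g : V -> R := fun x => g ((enorm x)^-1 *: x).

Definition L2sphere g : Prop := L2 (eball 1) (radial g).

Definition L2sphere_norm g : \bar R :=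
  ((Num.sqrt N%:R)%:E * L2norm (eball 1) (radial g))%E.

(* The trace on the unit sphere of u in H^1 of the unit ball (with weak
   gradient G) is g in L^2 of the sphere: the continuous extension to H^1 of
   the restriction to the sphere of the functions smooth up to the boundary. *)
Definition sphere_trace u G g : Prop :=
  L2sphere g /\
  exists phi : nat -> V -> R,
    [/\ forall m, smooth (phi m),
      L2norm (eball 1) (u \- phi m) @[m --> \oo] --> 0%E,
      forall i, L2norm (eball 1) (fun x => G x ord0 i - pderive i (phi m) x)
        @[m --> \oo] --> 0%E &
      L2sphere_norm (g \- phi m) @[m --> \oo] --> 0%E].

End function_spaces.

(* [k] is a transmission eigenvalue of the unit ball of R^N, with constant
   coefficients [sigma] and [n], and [(u, v)] is an associated pair of
   transmission eigenfunctions; the functions of H^1 are real-valued. *)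
Definition transmission_eigenpair (R : realType) (N : nat) (sigma n k : R)
    (u v : 'rV[R]_N -> R) : Prop :=
  let Omega : set 'rV[R]_N := eball 1 in
  0 < k /\
  ~ (u = cst 0 %[ae lebesgue_rV in Omega] /\
     v = cst 0 %[ae lebesgue_rV in Omega]) /\
  exists Gu Gv : 'rV[R]_N -> 'rV[R]_N,
    let div_sGu x := - (k ^+ 2 * n ^+ 2 * u x) in
    let div_Gv x := - (k ^+ 2 * v x) in
    [/\ H1 Omega u Gu /\ H1 Omega v Gv,
      weak_div Omega (fun x => sigma *: Gu x) div_sGu,
      weak_div Omega Gv div_Gv,
      exists g, sphere_trace u Gu g /\ sphere_trace v Gv g &
      eq_normal_trace Omega (fun x => sigma *: Gu x) div_sGu Gv div_Gv].

(* Main.v *)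
Require Import Defs.
From HB Require Import structures.
From mathcomp Require Import all_boot all_order all_algebra.
From mathcomp Require Import all_classical all_reals all_analysis.
From mathcomp Require Import measurable_realfun ring lra.
Import Order.TTheory GRing.Theory Num.Theory.
Import numFieldNormedType.Exports.
Local Open Scope classical_set_scope.
Local Open Scope ring_scope.

(** Separation of variables gives explicit candidates. Let [P_M] be the harmonic
    polynomial [Re (x_0 + i x_1)^M], put [a = M + N/2], and let [w] be the even
    entire function proportional to [x^(1-a) J_(a-1) (x)]. Then
    [P_M(x) w(K |x|)] solves [Delta f + K^2 f = 0]. With
    [kappa = n / sqrt sigma > 1] and [K = kappa k], the pair
      [u = alpha P_M(x) w(K |x|)], [v = beta P_M(x) w(k |x|)]
    solves both equations, and since the angular factors agree the two
    conditions on the sphere become a homogeneous 2 x 2 system for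
    [(alpha, beta)]. With [E(x) = M w(x) + x w'(x)], its determinant vanishes when
      [sigma E(K) w(k) = w(K) E(k)],
    and then [alpha = w(k)], [beta = w(K)] is a solution.

    Everything rests on the size of [K] compared to [M]. The logarithmic
    derivative [p = x F' / F] of the radial factor [F = x^M w] starts from [M] and
    obeys a Riccati equation which changes nature at the turning point [x ~ M].
    - Below it [F] is positive and grows: [p >= d] as long as
      [x^2 <= M^2 - d^2] ([ode_growth], [bw_growth]).
    - Beyond it [F] oscillates: [p] goes from [+oo] to [-oo] within a distance which
      is bounded on [[c M, lam M]] for fixed [1 < c < lam]
      ([ode_no_constant_sign]).
    Fix [lam > 1] so close to 1 that [lam <= kappa] and [lam tau < 1]. For [K] in
    [[M, lam M]] the number [k = K / kappa] is below the turning point, so that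
    [w(k)] and [E(k)] have a sign, while [F] oscillates arbitrarily often as [M]
    grows; hence the determinant takes both signs
    ([ode_functional_not_gt0]) and vanishes for some [K] in this range
    ([exists_transmission_root]). These [k] tend to infinity.

    On a ball of radius [rho > tau] with [lam rho < 1] both modes are still below
    the turning point, with [d] proportional to [M], so that
    [x . grad (u^2) >= 2 d u^2] there. Integrating the divergence of
    [x u^2 chi], for a radial cut-off [chi] supported in this ball, bounds the
    mass of [u^2] in the ball of radius [tau] by [C / d] times its total mass
    ([radial_growth_concentration]); this gives both limits without any
    asymptotics of Bessel functions.

    That the pair is a weak solution is integration by parts against compactly
    supported functions, which is Fubini's theorem. The equality of the normal
    traces needs no boundary integral: the field [X = sigma grad u - grad v] is
    tested against [chi_m phi], where [chi_m] tends to 1 and depends on [|x|] only.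
    The gradient of [chi_m] sees [x . X] alone, which vanishes on the sphere, and
    this compensates its size near the sphere ([normal_trace_eq0]). *)

Set Implicit Arguments.
Unset Strict Implicit.
Unset Printing Implicit Defensive.

(** * Monotonicity tools on the real line *)

Section real_tools.
Context {R : realType}.
Implicit Types (f df : R -> R) (a b : R).

Lemma continuous_derivable f df : (forall x : R, is_derive x 1 f (df x)) ->
  continuous f.
Proof.
by move=> fd x; apply/differentiable_continuous/derivable1_diffP; have [] := fd x.
Qed.

Lemma le_of_derive_ge0 f df a b : a <= b ->
  (forall x : R, x \in `[a, b] -> is_derive x 1 f (df x)) ->
  (forall x, x \in `]a, b[ -> 0 <= df x) -> f a <= f b.
Proof.
rewrite le_eqVlt => /predU1P[-> //|ab] fd df0.
have fd' (x : R) : x \in `]a, b[%R -> is_derive x 1 f (df x).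
  by rewrite in_itv /= => /andP[ax xb]; apply: fd; rewrite in_itv /= !ltW.
have cf : {within `[a, b], continuous f}.
  by apply: derivable_within_continuous => x /fd[].
have [c cab fE] := MVT ab fd' cf.
by rewrite -subr_ge0 fE mulr_ge0 ?df0// subr_ge0 ltW.
Qed.

Lemma derive_gt0_incr f (x d z : R) : is_derive x 1 f d -> 0 < d -> x < z ->
  exists2 y, x < y <= z & f x < f y.
Proof.
move=> [fx <-] d0 xz.
have P : \forall h \near 0^'+, 0 < h^-1 *: (f (h *: 1 + x) - f x).
  exact: cvgr_gt (cvg_dnbhs_at_right fx) _ d0.
near (0 : R)^'+ => h.
have h0 : 0 < h by near: h; exact: nbhs_right_gt.
have hz : h <= z - x by near: h; apply: nbhs_right_le; rewrite subr_gt0.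
have : 0 < h^-1 *: (f (h *: 1 + x) - f x) by near: h; exact: P.
rewrite pmulr_rgt0 ?invr_gt0// subr_gt0 [h *: 1]mulr1 => fh.
by exists (h + x) => //; apply/andP; split; lra.
Unshelve. all: by end_near. Qed.

Lemma first_zero f X : continuous f -> 0 <= X -> 0 < f 0 -> f X <= 0 ->
  exists2 x, x \in `]0, X] & f x = 0 /\ forall y, y \in `[0, x[ -> 0 < f y.
Proof.
move=> cf X0 f0 fX.
pose S := [set x | 0 <= x /\ f x <= 0].
have SX : S X by [].
have lbS : lbound S 0 by move=> x [].
have hS : has_inf S by split; [exists X | exists 0].
pose x := inf S.
have xX : x <= X by apply: ge_inf => //; exists 0.
have x0 : 0 <= x by apply: lb_le_inf => //; exists X.
have fpos y : y \in `[0, x[ -> 0 < f y.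
  rewrite in_itv /= => /andP[y0 yx]; rewrite ltNge; apply/negP => fy.
  by move: yx; rewrite ltNge => /negP; apply; apply: ge_inf; [exists 0|split].
have fx0 : f x <= 0.
  rewrite leNgt; apply/negP => fx.
  have /nbhs_ballP[e /= e0 be] : \forall y \near x, 0 < f y.
    exact: cvgr_gt (cf x) _ fx.
  have [s [s0 fs] se] := inf_adherent e0 hS.
  have xs : x <= s by apply: ge_inf => //; exists 0.
  have : 0 < f s.
    by apply: be; rewrite /ball /= ltr_distlC; apply/andP; split; rewrite /x in xs *; lra.
  by rewrite ltNge fs.
have xgt0 : 0 < x.
  rewrite lt_neqAle x0 andbT; apply/negP => /eqP x0E.
  by move: fx0; rewrite -x0E leNgt f0.
exists x; first by rewrite in_itv /= xgt0 xX.
split=> //; apply/eqP; rewrite eq_le fx0 /=.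
rewrite leNgt; apply/negP => fxn.
have /nbhs_ballP[e /= e0 be] : \forall y \near x, f y < 0.
  exact: cvgr_lt (cf x) _ fxn.
pose y := Num.max 0 (x - e / 2).
have yx : y < x by rewrite /y gt_max xgt0 /=; lra.
have y0 : 0 <= y by rewrite /y le_max lexx.
have ye : x - e / 2 <= y by rewrite /y le_max lexx orbT.
have /be : ball x e y.
  by rewrite /ball /= ltr_distlC; apply/andP; split; lra.
by rewrite ltNge ltW// fpos// in_itv /= y0.
Qed.

(** The derivative is only known to be positive where the function is
    nonnegative: the maximum of [f] on [[y, z]] rules out a return to 0. *)
Lemma barrier f df y z : y < z -> (forall x : R, is_derive x 1 f (df x)) ->
  0 <= f y -> (forall x, x \in `[y, z] -> 0 <= f x -> 0 < df x) -> 0 < f z.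
Proof.
move=> yz fd fy fpos; rewrite ltNge; apply/negP => fz.
have [|m myz mmax] := @EVT_max _ f y z (ltW yz).
  exact/continuous_subspaceT/(continuous_derivable fd).
have my : y \in `[y, z] by rewrite in_itv /= lexx ltW.
suff [m' m'yz [m'z m'max]] : exists2 m', m' \in `[y, z] &
    m' < z /\ forall t, t \in `[y, z] -> f t <= f m'.
  have m'0 : 0 <= f m' := le_trans fy (m'max _ my).
  have [t /andP[mt tz]] := derive_gt0_incr (fd m') (fpos _ m'yz m'0) m'z.
  rewrite ltNge m'max// in_itv /= tz andbT.
  by move: m'yz; rewrite in_itv /= => /andP[+ _]; lra.
have [mz|zm] := ltP m z; first by exists m.
have mE : m = z by move: myz; rewrite in_itv /= => /andP[]; lra.
exists y => //; split => // t tyz; rewrite (le_trans (mmax _ tyz))// mE.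
exact: le_trans fz fy.
Qed.

End real_tools.

(** * Oscillation and growth for a Bessel-type equation *)

(** Rules in pointwise form, so that they compose by unification. *)
Section derive_fun.
Context {R : realType} {V : normedModType R}.
Implicit Types (f g : V -> R) (x v : V).

Lemma is_derive_addf f g x v df dg : is_derive x v f df ->
  is_derive x v g dg -> is_derive x v (fun y => f y + g y) (df + dg).
Proof. by move=> fd gd; exact: is_deriveD. Qed.

Lemma is_derive_mulf f g x v df dg : is_derive x v f df ->
  is_derive x v g dg ->
  is_derive x v (fun y => f y * g y) (f x * dg + g x * df).
Proof. by move=> fd gd; exact: is_deriveM. Qed.

Lemma is_derive_scalef f (k : R) x v df : is_derive x v f df ->
  is_derive x v (fun y => k * f y) (k * df).
Proof. by move=> fd; exact: is_deriveZ. Qed.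

Lemma is_derive_compf (h : R -> R) f x v dh df :
  is_derive (f x) 1 h dh -> is_derive x v f df ->
  is_derive x v (fun y => h (f y)) (df * dh).
Proof.
move=> hd [fd fE].
have lineE (g : V -> R) : 'D_1 (fun t : R => g (t *: v + x)) 0 = 'D_v g x.
  rewrite /derive; set g1 := fun h => h^-1 *: _; set g2 := fun h => h^-1 *: _.
  suff -> : g1 = g2 by [].
  apply/funext => t; rewrite /g1 /g2 /=.
  by rewrite addr0 [_ *: 1]mulr1 scale0r add0r.
have fd0 : is_derive (0 : R) 1 (fun t : R => f (t *: v + x)) df.
  by apply: DeriveDef; [exact: (derivable1P _ _ _).1 | rewrite lineE].
have hd0 : is_derive (f (0 *: v + x)) 1 h dh by rewrite scale0r add0r.
have [dhf dhfE] := is_derive1_comp hd0 fd0.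
apply: DeriveDef; first exact: (derivable1P _ _ _).2.
by rewrite -(lineE (fun y => h (f y))) [LHS]dhfE mulrC.
Qed.

End derive_fun.

Lemma is_derive_powf {R : realType} (k : nat) (x : R) :
  is_derive x 1 (fun y : R => y ^+ k) (k%:R * x ^+ k.-1).
Proof.
have -> : (fun y : R => y ^+ k) = (id : R -> R) ^+ k.
  by apply/funext => y; elim: k => // k; rewrite !exprS => ->.
have := is_deriveX k (is_derive_id x (1 : R)).
by rewrite [_ *: _]mulr1.
Qed.

Section ode.
Context {R : realType}.
Variables (w w1 w2 : R -> R) (c : R).
Hypotheses (dw : forall x : R, is_derive x 1 w (w1 x))
  (dw1 : forall x : R, is_derive x 1 w1 (w2 x))
  (ode : forall x, x * w2 x + c * w1 x + x * w x = 0).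

(** In terms of [Z = beta w + x w'] the equation is the first-order system
    [(x^beta w)' = x^(beta-1) Z], [(x^delta Z)' = x^(delta-1) (beta delta - x^2) w],
    whose coefficients are nonnegative as long as [x^2 <= beta delta]: hence
    [w] and [Z] keep their initial sign. *)
Lemma ode_growth (beta delta : nat) X : (0 < beta)%N -> (0 < delta)%N ->
  c = (beta + delta + 1)%:R -> 0 <= X -> X ^+ 2 <= (beta * delta)%:R ->
  0 < w 0 -> forall x, 0 <= x <= X -> 0 < w x /\ 0 <= beta%:R * w x + x * w1 x.
Proof.
move=> b0 d0 cE X0 XE w0.
pose Z x := beta%:R * w x + x * w1 x.
have Zge0 x : 0 <= x <= X -> (forall y, 0 <= y < x -> 0 < w y) -> 0 <= Z x.
  move=> /andP[x0 xX] wpos; have [->|xn0] := eqVneq x 0.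
    by rewrite /Z mul0r addr0 mulr_ge0// ltW.
  have xgt0 : 0 < x by rewrite lt_neqAle eq_sym xn0.
  pose h (y : R) := y ^+ delta * Z y.
  suff : h 0 <= h x.
    by rewrite /h expr0n gtn_eqF// mul0r pmulr_rge0// exprn_gt0.
  pose dh (y : R) := y ^+ delta.-1 * ((beta * delta)%:R - y ^+ 2) * w y.
  apply: (@le_of_derive_ge0 _ h dh) => // y; rewrite in_itv /= => /andP[y0 yx].
    have := is_derive_mulf (is_derive_powf delta y) (is_derive_addf
      (is_derive_scalef beta%:R (dw y)) (is_derive_mulf (is_derive_id y 1) (dw1 y))).
    move=> /is_derive_eq; apply; rewrite /dh /=.
    have := ode y; rewrite cE -(prednK d0) !natrD natrM /= exprS -!natr1.
    set p := y ^+ _; set b := beta%:R; set d := _%:R; set wy := w y.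
    move=> /(canRL (addrK _)) /(canRL (addrK _)); rewrite add0r => E.
    have -> : y * p * (b * w1 y + (y * w2 y + w1 y * 1)) +
       (b * wy + y * w1 y) * ((d + 1) * p) =
       p * y * (y * w2 y) + p * y * (b * w1 y + w1 y) + (b * wy + y * w1 y) * ((d + 1) * p).
      by ring.
    by rewrite E; ring.
  rewrite /dh mulr_ge0//; last by rewrite ltW// wpos// ltW.
  rewrite mulr_ge0//; first by rewrite exprn_ge0// ltW.
  rewrite subr_ge0 (le_trans _ XE)// lerXn2r// ?nnegrE//; first exact: ltW.
  exact/ltW/(lt_le_trans yx).
have wpos x : 0 <= x <= X -> 0 < w x.
  move=> /andP[x0 xX]; rewrite ltNge; apply/negP => wx.
  have [z] := first_zero (continuous_derivable dw) x0 w0 wx.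
  rewrite in_itv /= => /andP[z0 zx] [wz wpos].
  have wpos' y : 0 <= y < z -> 0 < w y by move=> yz; apply: wpos; rewrite in_itv.
  pose h (y : R) := y ^+ beta * w y.
  suff : h (z / 2) <= h z.
    rewrite /h wz mulr0 leNgt => /negP; apply; rewrite mulr_gt0//.
      by rewrite exprn_gt0// divr_gt0.
    by apply: wpos'; apply/andP; split; lra.
  pose dh (y : R) := y ^+ beta.-1 * Z y.
  apply: (@le_of_derive_ge0 _ h dh) => [|y|y]; first by lra.
    move=> _; have := is_derive_mulf (is_derive_powf beta y) (dw y).
    move=> /is_derive_eq; apply; rewrite /dh /Z /=.
    by rewrite -(prednK b0) exprS /=; ring.
  rewrite in_itv /= => /andP[zy yz]; rewrite mulr_ge0//.
    by rewrite exprn_ge0//; lra.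
  apply: Zge0; first by apply/andP; split; lra.
  by move=> t /andP[t0 ty]; apply: wpos'; rewrite t0 (lt_trans ty).
move=> x xX; split; first exact: wpos.
apply: Zge0 => // y /andP[y0 yx]; apply: wpos; rewrite y0 /=.
by move: xX => /andP[_]; exact/le_trans/ltW.
Qed.

(** The energy [w^2 + w'^2] decreases at the relative rate [2c / x] at most, so that
    [x^(2c) (w^2 + w'^2)] is nondecreasing. *)
Lemma ode_nonvanishing (k : nat) y x : c = k%:R -> 0 < y -> y <= x ->
  w y != 0 -> w x = 0 -> w1 x != 0.
Proof.
move=> cE y0 yx wy wx; apply/eqP => w1x.
pose h (t : R) := t ^+ (2 * k) * (w t ^+ 2 + w1 t ^+ 2).
have : h y <= h x.
  pose dh (t : R) := (2 * k)%:R * t ^+ (2 * k).-1 * w t ^+ 2.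
  apply: (@le_of_derive_ge0 _ h dh) => // t; rewrite in_itv /= => /andP[yt tx].
    have := is_derive_mulf (is_derive_powf (2 * k) t) (is_derive_addf
      (is_derive_compf (is_derive_powf 2 (w t)) (dw t))
      (is_derive_compf (is_derive_powf 2 (w1 t)) (dw1 t))).
    move=> /is_derive_eq; apply; rewrite /dh /=.
    have t0 : t != 0 by rewrite gt_eqF// (lt_le_trans y0).
    have -> : w2 t = - (c * w1 t) / t - w t.
      apply: (mulfI t0); rewrite mulrBr mulrCA divff// mulr1.
      by have := ode t; lra.
    have kE : t ^+ (2 * k) * c = t ^+ (2 * k).-1 * t * c.
      by rewrite cE; case: (k) => [|k']; rewrite ?mulr0// mulnS -exprSr.
    rewrite natrM -cE; move: kE; set p := t ^+ (2 * k); set q := t ^+ _.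
    move=> kE.
    have -> : p * (w1 t * (2 * w t ^+ 1) + (- (c * w1 t) / t - w t) * (2 * w1 t ^+ 1))
       = - (2 * w1 t ^+ 2) * (p * c) / t by field.
    by rewrite kE; field.
  have t0 : 0 <= t by lra.
  by rewrite /dh mulr_ge0 ?sqr_ge0// mulr_ge0// exprn_ge0.
rewrite {2}/h wx w1x expr0n /= addr0 mulr0 leNgt => /negP; apply.
rewrite /h mulr_gt0 ?exprn_gt0// ltr_pwDl ?sqr_ge0//.
by rewrite lt_neqAle sqr_ge0 eq_sym sqrf_eq0 wy.
Qed.

End ode.

Section oscillation.
Context {R : realType}.

(** The logarithmic derivative [p = M + x w'/w] satisfies
    [x p' = - (p^2 + nu p + x^2 - M (M + nu)) <= - (p^2 + A^2) / 2], so that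
    [atan (p / A)] decreases at speed at least [A / (2 X)], while its range has
    length [pi]. *)
Lemma ode_no_constant_sign (w w1 w2 : R -> R) (M nu A x0 X : R) :
  (forall x : R, is_derive x 1 w (w1 x)) ->
  (forall x : R, is_derive x 1 w1 (w2 x)) ->
  (forall x, x * w2 x + (2 * M + nu + 1) * w1 x + x * w x = 0) ->
  0 < x0 -> x0 < X -> 0 < A ->
  M * (M + nu) + nu ^+ 2 / 2 + A ^+ 2 / 2 <= x0 ^+ 2 ->
  2 * pi * X <= A * (X - x0) ->
  ~ (forall x, x0 <= x <= X -> 0 < w x).
Proof.
move=> dw dw1 ode x00 x0X A0 x0A AX wpos.
pose E x := M * w x + x * w1 x.
pose dE x := M * w1 x + (x * w2 x + w1 x).
pose dp x := E x * (- (w x) ^- 2 * w1 x) + (w x)^-1 * dE x.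
pose p x := E x * (w x)^-1.
have pd (x : R) : x0 <= x <= X -> is_derive x 1 p (dp x).
  move=> xX; have wn0 : w x != 0 by rewrite gt_eqF// wpos.
  have Ed : is_derive x 1 E (dE x).
    have := is_derive_addf (is_derive_scalef M (dw x))
      (is_derive_mulf (is_derive_id x (1 : R)) (dw1 x)).
    by move/is_derive_eq; apply; rewrite /dE mulr1.
  exact: (is_derive_mulf Ed (is_deriveV wn0 (dw x))).
have dpE x : x0 <= x <= X ->
    dp x = - (p x ^+ 2 + nu * p x + x ^+ 2 - M * (M + nu)) / x.
  move=> xX; have wn0 : w x != 0 by rewrite gt_eqF// wpos.
  have xn0 : x != 0 by rewrite gt_eqF//; lra.
  have -> : dp x = E x * (- (w x) ^- 2 * w1 x) +
      (w x)^-1 * (M * w1 x + (- (2 * M + nu + 1) * w1 x - x * w x + w1 x)).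
    by rewrite /dp /dE; congr (_ + _ * (_ + (_ + _))); have := ode x; lra.
  by rewrite /p /E; field; rewrite xn0 wn0.
pose s := A / (2 * X).
pose h x := - atan (A^-1 * p x) - s * x.
pose dh x := - ((A^-1 * dp x) * (1 + (A^-1 * p x) ^+ 2)^-1) - s.
have X0 : 0 < X by lra.
have : h x0 <= h X.
  apply: (@le_of_derive_ge0 _ h dh) => [|x|x]; first exact: ltW.
    rewrite in_itv /= => xX.
    have ad := @is_derive_compf _ _ atan (fun y => A^-1 * p y) x 1 _ _
      (is_derive1_atan _) (is_derive_scalef A^-1 (pd x xX)).
    have := is_derive_addf (is_derive_scalef (-1) ad)
      (is_derive_scalef (- s) (is_derive_id x (1 : R))).
    have -> : (fun y => -1 * atan (A^-1 * p y) + - s * id y) = h.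
      by apply/funext => y; rewrite /h /=; ring.
    by move/is_derive_eq; apply; rewrite /dh mulr1; ring.
  rewrite in_itv /= => /andP[x0x xX].
  have xgt0 : 0 < x by lra.
  rewrite /dh dpE; last by apply/andP; split; exact: ltW.
  set P := p x; set Q := P ^+ 2 + nu * P + x ^+ 2 - M * (M + nu).
  have QA : (P ^+ 2 + A ^+ 2) / 2 <= Q.
    have : x0 ^+ 2 <= x ^+ 2 by rewrite lerXn2r// ?nnegrE; lra.
    by have := sqr_ge0 (P + nu); rewrite /Q; nra.
  have PA : 0 < P ^+ 2 + A ^+ 2 by rewrite ltr_wpDl ?sqr_ge0// exprn_gt0.
  have -> : - (A^-1 * (- Q / x) * (1 + (A^-1 * P) ^+ 2)^-1) =
      A * Q / (x * (P ^+ 2 + A ^+ 2)).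
    by field; rewrite !gt_eqF//; nra.
  rewrite subr_ge0 /s ler_pdivlMr ?mulr_gt0// mulrAC ler_pdivrMr ?mulr_gt0//.
  rewrite -!mulrA ler_pM2l//.
  have Q0 : 0 <= Q by rewrite (le_trans _ QA)// divr_ge0// ltW.
  have : x * (P ^+ 2 + A ^+ 2) <= x * (2 * Q) by rewrite ler_pM2l//; lra.
  have : x * (2 * Q) <= X * (2 * Q) by rewrite ler_wpM2r ?mulr_ge0// ltW.
  by lra.
rewrite /h.
have := atan_gtNpi2 (A^-1 * p X); have := atan_ltpi2 (A^-1 * p x0).
have : pi <= s * (X - x0).
  rewrite /s mulrAC ler_pdivlMr ?mulr_gt0//; lra.
by rewrite mulrBr; lra.
Qed.

(** If [sigma (M w + x w') a - w b] were positive throughout, then [x^M w] would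
    increase wherever [w >= 0]: it could only cross 0 upwards, hence once, and [w]
    would keep a constant sign on the first or on the last third of the
    interval. *)
Lemma ode_functional_not_gt0 (w w1 w2 a b : R -> R) (M : nat)
    (nu A sigma x1 x2 x3 x4 : R) :
  (forall x : R, is_derive x 1 w (w1 x)) ->
  (forall x : R, is_derive x 1 w1 (w2 x)) ->
  (forall x, x * w2 x + (2 * M%:R + nu + 1) * w1 x + x * w x = 0) ->
  (0 < M)%N -> 0 < sigma -> 0 < x1 -> x1 < x2 -> x2 < x3 -> x3 < x4 -> 0 < A ->
  M%:R * (M%:R + nu) + nu ^+ 2 / 2 + A ^+ 2 / 2 <= x1 ^+ 2 ->
  2 * pi * x4 <= A * (x2 - x1) -> 2 * pi * x4 <= A * (x4 - x3) ->
  (forall x, x1 <= x <= x4 -> 0 < a x /\ 0 <= b x) ->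
  ~ (forall x, x1 <= x <= x4 ->
       0 < sigma * (M%:R * w x + x * w1 x) * a x - w x * b x).
Proof.
move=> dw dw1 ode M0 s0 x10 x12 x23 x34 A0 Ax A12 A34 ab Dpos.
have pi0 := @pi_gt0 R.
have [y [yx wy]] : exists y, x1 <= y <= x2 /\ 0 <= w y.
  apply: contrapT => /forallNP wneg.
  apply: (@ode_no_constant_sign (fun x => -1 * w x) (fun x => -1 * w1 x)
    (fun x => -1 * w2 x) M%:R nu A x1 x2) => //.
  - by move=> x; have := ode x; lra.
  - by rewrite (le_trans _ A12)// ler_pM2l ?mulr_gt0//; lra.
  - move=> x xx; have /not_andP[//|/negP] := wneg x.
    by rewrite -ltNge; lra.
apply: (@ode_no_constant_sign w w1 w2 M%:R nu A x3 x4) => //; first lra.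
  by rewrite (le_trans Ax)// lerXn2r// ?nnegrE; lra.
move=> x xx; move: yx => /andP[x1y yx2]; move: xx => /andP[x3x xx4].
pose F (t : R) := t ^+ M * w t.
pose dF (t : R) := t ^+ M.-1 * (M%:R * w t + t * w1 t).
suff : 0 < F x by rewrite /F pmulr_rgt0// exprn_gt0//; lra.
apply: (@barrier _ F dF y) => [||| t]; first lra.
- move=> t; have := is_derive_mulf (is_derive_powf M t) (dw t).
  move/is_derive_eq; apply; rewrite /dF.
  by rewrite -(prednK M0) exprS /=; ring.
- by rewrite /F mulr_ge0// exprn_ge0//; lra.
rewrite in_itv /= => /andP[yt tx].
have t0 : 0 < t by lra.
rewrite /F pmulr_rge0 ?exprn_gt0// => wt.
have tx4 : x1 <= t <= x4 by apply/andP; split; lra.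
have [at0 bt] := ab _ tx4.
rewrite /dF pmulr_rgt0 ?exprn_gt0//.
have : 0 < sigma * (M%:R * w t + t * w1 t) * a t.
  by have := Dpos _ tx4; have := mulr_ge0 wt bt; lra.
by rewrite pmulr_lgt0// pmulr_rgt0.
Qed.

End oscillation.

(** * The normalised Bessel functions *)

Section bessel.
Context {R : realType}.
Implicit Types (a t x : R).

Definition rising a (i : nat) : R := \prod_(j < i) (a + j%:R).

Lemma rising0 a : rising a 0 = 1.
Proof. by rewrite /rising big_ord0. Qed.

Lemma risingSr a i : rising a i.+1 = rising a i * (a + i%:R).
Proof. by rewrite /rising big_ord_recr. Qed.

Lemma risingS a i : rising a i.+1 = a * rising (a + 1) i.
Proof.
rewrite /rising big_ord_recl /= addr0; congr (_ * _).
by apply: eq_bigr => j _; rewrite /bump /= natrD addrA.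
Qed.

Lemma rising_ge1 a i : 1 <= a -> 1 <= rising a i.
Proof.
move=> a1; elim: i => [|i ih]; first by rewrite rising0.
by rewrite risingSr mulr_ege1// (le_trans a1)// lerDl.
Qed.

Definition bessel_coef a (i : nat) : R :=
  (- 4^-1) ^+ i / (i`!%:R * rising a i).

(** Up to a factor [x^(a-1)] and a constant, [x |-> bessel a (x^2)] is the
    Bessel function of the first kind of order [a - 1]. *)
Definition bessel a t : R := limn (pseries (bessel_coef a) t).

Lemma is_cvg_bessel a t : 1 <= a -> cvgn (pseries (bessel_coef a) t).
Proof.
move=> a1; apply: normed_cvg.
apply: (@series_le_cvg _ _ (exp_coeff `|t|)); last exact: is_cvg_series_exp_coeff.
- by move=> i /=; exact: normr_ge0.
- by move=> i; exact: exp_coeff_ge0.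
move=> i; rewrite /exp_coeff /= /bessel_coef normrM normrX mulrC.
rewrite ler_wpM2l ?exprn_ge0// normrM normfV normrM normrX normrN.
have r1 := rising_ge1 i a1.
have f0 : 0 < i`!%:R :> R by rewrite ltr0n fact_gt0.
rewrite (ger0_norm (ltW f0)) [`|rising a i|]ger0_norm ?(le_trans ler01)//.
rewrite invfM [i`!%:R^-1 * _]mulrC mulrA ler_piMl ?invr_ge0 ?(ltW f0)//.
rewrite mulr_ile1// ?normr_ge0 ?exprn_ge0 ?invr_ge0 ?(le_trans ler01)//.
  by rewrite exprn_ile1// ger0_norm ?invr_ge0// invf_le1 ?ler1n.
by rewrite invf_le1 ?(lt_le_trans ltr01).
Qed.

Arguments is_cvg_bessel a t : clear implicits.

Lemma bessel_coef_diffs a : 1 <= a ->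
  pseries_diffs (bessel_coef a) = - (4 * a)^-1 *: bessel_coef (a + 1).
Proof.
move=> a1; apply/funext => i; rewrite /pseries_diffs /bessel_coef /=.
rewrite risingS factS natrM exprS.
have a0 : a != 0 by rewrite gt_eqF// (lt_le_trans ltr01).
have r0 : rising (a + 1) i != 0.
  by rewrite gt_eqF// (lt_le_trans ltr01)// rising_ge1//; lra.
have f0 : i`!%:R != 0 :> R by rewrite pnatr_eq0 -lt0n fact_gt0.
have i0 : i.+1%:R != 0 :> R by rewrite pnatr_eq0.
transitivity (- (4 * a)^-1 *
  ((- 4^-1) ^+ i / (i`!%:R * rising (a + 1) i))); last by [].
move: f0 r0 i0; set p := _ ^+ i; set r := rising _ _; set f := i`!%:R.
by move=> f0 r0; rewrite -natr1 => i0; field; rewrite i0 f0 r0 a0.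
Qed.

Lemma pseriesZ (c : nat -> R) (k t : R) :
  pseries (k *: c) t = k *: pseries c t.
Proof.
rewrite /pseries -seriesZ; congr (series _).
by apply/funext => i; exact: (esym (mulrA k (c i) (t ^+ i))).
Qed.

Lemma is_derive_bessel a t : 1 <= a ->
  is_derive t 1 (bessel a) (- (4 * a)^-1 * bessel (a + 1) t).
Proof.
move=> a1; have a2 : 1 <= a + 1 by lra.
have a3 : 1 <= a + 1 + 1 by lra.
have := @pseries_snd_diffs R (bessel_coef a) (`|t| + 1) t.
have dE (b : R) (c : nat -> R) : pseries_diffs (b *: c) = b *: pseries_diffs c.
  by apply/funext => i; exact: (mulrCA i.+1%:R b (c i.+1)).
rewrite !(bessel_coef_diffs, dE)// !pseriesZ.
move=> /(_ (is_cvg_bessel a _ a1) (is_cvgZl_tmp (is_cvg_bessel (a + 1) _ a2))).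
move=> /(_ (is_cvgZl_tmp (is_cvgZl_tmp (is_cvg_bessel (a + 1 + 1) _ a3)))).
rewrite limZl_tmp//; last exact: is_cvg_bessel.
apply; rewrite [`|_ + 1|]ger0_norm; last by rewrite addr_ge0.
by rewrite ltrDl.
Qed.

Lemma bessel0 a : 1 <= a -> bessel a 0 = 1.
Proof.
move=> a1; apply: (@cvg_lim _ _ _ \oo) => //.
rewrite -(cvg_shiftS (pseries (bessel_coef a) 0)).
apply: cvg_near_cst; near=> n => /=.
rewrite /pseries /series /= big_nat_recl// big1 ?addr0.
  by rewrite /bessel_coef fact0 rising0 !expr0 !mulr1 mul1r; exact: invr1.
by move=> i _; rewrite expr0n /= mulr0.
Unshelve. all: by end_near. Qed.

(** As differentiation shifts the parameter, this relation is the differential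
    equation of [bessel]. *)
Lemma bessel_contiguous a t : 1 <= a ->
  bessel a t - bessel (a + 1) t = - (4 * a * (a + 1))^-1 * (t * bessel (a + 2) t).
Proof.
move=> a1; have a2 : 1 <= a + 1 by lra.
have a3 : 1 <= a + 2 by lra.
have cE i : bessel_coef a i.+1 - bessel_coef (a + 1) i.+1 =
    - (4 * a * (a + 1))^-1 * bessel_coef (a + 2) i.
  have r0 : rising (a + 2) i != 0.
    by rewrite gt_eqF// (lt_le_trans ltr01)// rising_ge1.
  have ai0 : a + i.+1%:R != 0 by rewrite gt_eqF// ltr_wpDr//; lra.
  have E : rising a i.+1 = a * (a + 1) * rising (a + 2) i / (a + i.+1%:R).
    apply: (mulIf ai0); rewrite -risingSr divfK// !risingS.
    by rewrite mulrA -addrA.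
  rewrite /bessel_coef E [rising (a + 1) _]risingS -addrA.
  rewrite factS natrM exprS; move: ai0; rewrite -natr1 => ai0.
  have f0 : i`!%:R != 0 :> R by rewrite pnatr_eq0 -lt0n fact_gt0.
  have i0 : i%:R + 1 != 0 :> R by rewrite natr1 pnatr_eq0.
  have [a0 a10] : a != 0 /\ a + 1 != 0 by split; rewrite gt_eqF//; lra.
  move: f0 r0; set p := _ ^+ i; set r := rising _ _; set f := _`!%:R => f0 r0.
  by field; rewrite ai0 i0 f0 r0 a0 a10.
have lim_ b : 1 <= b -> (pseries (bessel_coef b) t) @ \oo --> bessel b t.
  by move=> b1; exact: is_cvg_bessel.
have l1 := cvgB (lim_ _ a1) (lim_ _ a2).
have l2 : (pseries (bessel_coef a) t - pseries (bessel_coef (a + 1)) t) @ \oo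
    --> - (4 * a * (a + 1))^-1 * (t * bessel (a + 2) t).
  rewrite -cvg_shiftS.
  have l3 : - (4 * a * (a + 1))^-1 * (t * pseries (bessel_coef (a + 2)) t m)
      @[m --> \oo] --> - (4 * a * (a + 1))^-1 * (t * bessel (a + 2) t).
    by apply: cvgMl_tmp; apply: cvgMl_tmp; exact: lim_.
  apply: cvg_trans l3; apply: near_eq_cvg; near=> n.
  rewrite /pseries /series /= !fctE /series /= !big_nat_recl// !expr0.
  have -> : bessel_coef (a + 1) 0 = bessel_coef a 0.
    by rewrite /bessel_coef !rising0.
  rewrite opprD addrACA subrr add0r -sumrB !mulr_sumr; apply: eq_bigr => i _.
  by rewrite -mulrBl cE exprS; ring.
by rewrite -(cvg_lim _ l2)// (cvg_lim _ (l1 _)).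
Unshelve. all: by end_near. Qed.

Definition bw a x := bessel a (x ^+ 2).
Definition bw1 a x := - (2 * a)^-1 * (x * bessel (a + 1) (x ^+ 2)).
Definition bw2 a x := - (2 * a)^-1 *
  (bessel (a + 1) (x ^+ 2) - x ^+ 2 * (2 * (a + 1))^-1 * bessel (a + 2) (x ^+ 2)).

Lemma is_derive_bw a x : 1 <= a -> is_derive x 1 (bw a) (bw1 a x).
Proof.
move=> a1; have := @is_derive_compf _ _ (bessel a) (fun x => x ^+ 2) x 1 _ _
  (is_derive_bessel _ a1) (is_derive_powf 2 x).
move/is_derive_eq; apply; rewrite /bw1 /=; field.
by rewrite gt_eqF//; lra.
Qed.

Lemma is_derive_bw1 a x : 1 <= a -> is_derive x 1 (bw1 a) (bw2 a x).
Proof.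
move=> a1; have a2 : 1 <= a + 1 by lra.
have := is_derive_scalef (- (2 * a)^-1) (is_derive_mulf (is_derive_id x 1)
  (@is_derive_compf _ _ (bessel (a + 1)) (fun x => x ^+ 2) x 1 _ _
  (is_derive_bessel _ a2) (is_derive_powf 2 x))).
move/is_derive_eq; apply; rewrite /bw2 /= -addrA.
have -> : 1 + 1 = 2 :> R by [].
by field; rewrite !gt_eqF//; lra.
Qed.

Lemma bw_ode a x : 1 <= a ->
  x * bw2 a x + (2 * a - 1) * bw1 a x + x * bw a x = 0.
Proof.
move=> a1; rewrite /bw2 /bw1 /bw.
have -> : bessel a (x ^+ 2) = bessel (a + 1) (x ^+ 2) +
    - (4 * a * (a + 1))^-1 * (x ^+ 2 * bessel (a + 2) (x ^+ 2)).
  by rewrite -bessel_contiguous//; ring.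
by field; rewrite !gt_eqF//; lra.
Qed.

End bessel.

(** * Transmission eigenvalues near the first zeros of the Bessel functions *)

Section roots.
Context {R : realType}.
Implicit Types (x kappa sigma lam tau : R).

(** The parameter [a] for which [x |-> bessel a (K^2 |x|^2)], multiplied by a
    harmonic polynomial of degree [M] in [N] variables, is an eigenfunction of the
    Laplacian. *)
Definition order_of (N M : nat) : R := M%:R + N%:R / 2.

(** [x^(M-1) bE N M x] is the derivative of the radial factor
    [x^M bw (order_of N M) x]. *)
Definition bE N M x := M%:R * bw (order_of N M) x + x * bw1 (order_of N M) x.

Lemma order_of_ge1 N M : (1 < N)%N -> 1 <= order_of N M.
Proof.
move=> N1; have N2 : 2 <= N%:R :> R by rewrite (ler_nat _ 2).
rewrite /order_of -[leLHS]add0r lerD//; lra.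
Qed.

Lemma order_of_ode N M x : (1 < N)%N ->
  let a := order_of N M in
  x * bw2 a x + (2 * M%:R + (N%:R - 2) + 1) * bw1 a x + x * bw a x = 0.
Proof.
move=> N1 /=; rewrite -[RHS](@bw_ode _ (order_of N M) x) ?order_of_ge1//.
by congr (_ + _ * _ + _); rewrite /order_of; field.
Qed.

(** For [M = b + d] the bound [b (b + 2 d)] is [M^2 - d^2]: the room left before the
    turning point [x = M] is paid back as growth of the radial factor. *)
Lemma bw_growth N (b d : nat) X : (1 < N)%N -> (0 < b)%N ->
  0 <= X -> X ^+ 2 <= b%:R * (b + 2 * d)%:R ->
  forall x, 0 <= x <= X ->
  0 < bw (order_of N (b + d)) x /\
  d%:R * bw (order_of N (b + d)) x <= bE N (b + d) x.
Proof.
move=> N1 b0 X0 Xb x xX; set M := (b + d)%N.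
have a1 := order_of_ge1 M N1.
have d0 : (0 < b + 2 * d + (N - 2))%N by rewrite !addn_gt0 b0.
have cE : 2 * M%:R + (N%:R - 2) + 1 = (b + (b + 2 * d + (N - 2)) + 1)%:R :> R.
  by rewrite /M !natrD natrB//; ring.
have XE : X ^+ 2 <= (b * (b + 2 * d + (N - 2)))%:R.
  by rewrite (le_trans Xb)// -natrM ler_nat leq_mul2l leq_addr orbT.
have w0 : 0 < bw (order_of N M) 0 by rewrite /bw expr0n /= bessel0.
have [] := @ode_growth _ _ _ _ _ (fun y => is_derive_bw y a1)
  (fun y => is_derive_bw1 y a1) (fun y => order_of_ode M y N1) b _ X b0 d0 cE
  X0 XE w0 x xX.
by move=> wx Zx; split=> //; rewrite /bE /M natrD mulrDl -subr_ge0; lra.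
Qed.

(** Between [M] and [lam M] the argument [x / kappa] has not reached the turning
    point while [x] is beyond it: the coefficients [bw] and [bE] at the former have a
    sign, [bw] at the latter oscillates, and the difference of the two sides of the
    equation changes sign. *)
Lemma exists_transmission_root N kappa sigma lam : (1 < N)%N ->
  1 < lam -> lam <= kappa -> 0 < sigma ->
  \forall M \near \oo, exists x, [/\ M%:R <= x <= lam * M%:R,
    sigma * bE N M x * bw (order_of N M) (x / kappa) =
      bw (order_of N M) x * bE N M (x / kappa),
    bw (order_of N M) x != 0 & 0 < bw (order_of N M) (x / kappa)].
Proof.
move=> N1 l1 lk s0.
pose nu : R := N%:R - 2.
have nu0 : 0 <= nu by rewrite subr_ge0 (ler_nat _ 2).
pose e := (lam - 1) / 4.
have e0 : 0 < e by rewrite divr_gt0// subr_gt0.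
(* This value of [A] is independent of [M] and makes the total decrease of
   [atan (p / A)] over an interval of length [e M] below [lam M] at least [pi]. *)
pose A := 2 * pi * lam / e.
have pi0 := @pi_gt0 R.
have A0 : 0 < A by rewrite /A !mulr_gt0// ?invr_gt0//; lra.
have Ae : A * e = 2 * pi * lam by rewrite /A divfK// gt_eqF.
clearbody A.
pose B := (nu + nu ^+ 2 / 2 + A ^+ 2 / 2) / (2 * e).
near=> M.
have M0 : (0 < M)%N by near: M; exists 1%N.
have M1 : 1 <= M%:R :> R by rewrite (ler_nat _ 1).
have BM : nu + nu ^+ 2 / 2 + A ^+ 2 / 2 <= 2 * e * M%:R.
  have e2 : 0 < 2 * e by rewrite mulr_gt0.
  rewrite [leRHS]mulrC -ler_pdivrMr// -/B.
  by near: M; exact: nbhs_infty_ger.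
set a := order_of N M; have a1 : 1 <= a := order_of_ge1 M N1.
(* [x_ 1], ..., [x_ 4] cut the end of [[M, lam M]] into thirds. *)
pose x_ (i : R) := M%:R * (1 + i * e).
have x4E : x_ 4 = lam * M%:R by rewrite /x_ /e; field.
have x0 i : 0 <= i -> M%:R <= x_ i.
  by move=> i0; rewrite /x_ ler_peMr ?ler0n// lerDl mulr_ge0// ltW.
have xlt i j : i < j -> x_ i < x_ j.
  by move=> ij; rewrite /x_ ltr_pM2l ?ltr0n// ltrD2l ltr_pM2r.
have k0 : 0 < kappa by lra.
have below x : 0 <= x <= M%:R -> 0 < bw a x /\ 0 <= bE N M x.
  move=> xM; have := @bw_growth N M 0 M%:R N1 M0 (ler0n _ _) _ x xM.
  by rewrite mul0r muln0 !addn0 -natrM expr2 natrM; exact.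
have ab x : x_ 1 <= x <= x_ 4 ->
    0 < bw a (x / kappa) /\ 0 <= bE N M (x / kappa).
  move=> /andP[x1 x4]; have xgt0 : 0 < x.
    by rewrite (lt_le_trans _ x1)// (lt_le_trans _ (x0 1 ler01))// ltr0n.
  apply: below; apply/andP; split; first by rewrite divr_ge0// ltW.
  by rewrite ler_pdivrMr// (le_trans x4)// x4E mulrC ler_wpM2l.
have key (s : R) : s ^+ 2 = 1 -> ~ (forall x, x_ 1 <= x <= x_ 4 ->
    0 < sigma * (M%:R * (s * bw a x) + x * (s * bw1 a x)) * bw a (x / kappa)
        - (s * bw a x) * bE N M (x / kappa)).
  move=> s1.
  have d1 (x : R) : is_derive x 1 (fun y => s * bw a y) (s * bw1 a x).
    exact: (is_derive_scalef s (is_derive_bw x a1)).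
  have d2 (x : R) : is_derive x 1 (fun y => s * bw1 a y) (s * bw2 a x).
    exact: (is_derive_scalef s (is_derive_bw1 x a1)).
  have sode (x : R) : x * (s * bw2 a x) + (2 * M%:R + nu + 1) * (s * bw1 a x) +
      x * (s * bw a x) = 0.
    have := @order_of_ode N M x N1; rewrite -/nu -/a => /= E.
    by rewrite -[RHS](mulr0 s) -E; ring.
  apply: (ode_functional_not_gt0 d1 d2 sode M0 s0 _ _ _ _ A0 _ _ _ ab
    (x2 := x_ 2) (x3 := x_ 3)).
  - by rewrite (lt_le_trans _ (x0 1 ler01))// ltr0n.
  - by apply: xlt; lra.
  - by apply: xlt; lra.
  - by apply: xlt; lra.
  - rewrite /x_ mul1r exprMn.
    have : nu * M%:R + nu ^+ 2 / 2 + A ^+ 2 / 2 <= 2 * e * M%:R * M%:R.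
      apply: le_trans (ler_wpM2r (ler0n _ M) BM).
      have : (nu ^+ 2 + A ^+ 2) * 1 <= (nu ^+ 2 + A ^+ 2) * M%:R.
        by rewrite ler_wpM2l// addr_ge0 ?sqr_ge0.
      by lra.
    by have := sqr_ge0 (e * M%:R); lra.
  - rewrite x4E; have -> : x_ 2 - x_ 1 = e * M%:R by rewrite /x_; ring.
    by rewrite [leRHS]mulrA Ae mulrA.
  - rewrite {2}x4E -x4E; have -> : x_ 4 - x_ 3 = e * M%:R by rewrite /x_; ring.
    by rewrite x4E [leRHS]mulrA Ae mulrA.
pose D x := sigma * bE N M x * bw a (x / kappa) - bw a x * bE N M (x / kappa).
have cw : continuous (bw a).
  exact: (continuous_derivable (fun x => is_derive_bw x a1)).
have cw1 : continuous (bw1 a).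
  exact: (continuous_derivable (fun x => is_derive_bw1 x a1)).
have cE : continuous (bE N M).
  move=> x; apply: cvgD; first by apply: cvgMl_tmp; exact: cw.
  by apply: cvgM; [exact: cvg_id | exact: cw1].
have ck : continuous (fun x => x / kappa).
  by move=> x; apply: cvgMr_tmp; exact: cvg_id.
have cD : continuous D.
  move=> x; apply: cvgB; apply: cvgM.
  - by apply: cvgMl_tmp; exact: cE.
  - by apply: (@continuous_comp _ _ _ (fun x => x / kappa) (bw a));
      [exact: ck | exact: cw].
  - exact: cw.
  - by apply: (@continuous_comp _ _ _ (fun x => x / kappa) (bE N M));
      [exact: ck | exact: cE].
have [y [yx Dy]] : exists y, x_ 1 <= y <= x_ 4 /\ D y <= 0.
  apply: contrapT => /forallNP h; apply: (key 1); first by rewrite expr1n.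
  move=> x xx; have /not_andP[//|/negP] := h x.
  by rewrite -ltNge /D /bE !mul1r.
have [z [zx Dz]] : exists z, x_ 1 <= z <= x_ 4 /\ 0 <= D z.
  apply: contrapT => /forallNP h; apply: (key (-1)); first by rewrite sqrrN expr1n.
  move=> x xx; have /not_andP[//|/negP] := h x.
  by rewrite -ltNge /D /bE; lra.
have [x xyz Dx] : exists2 x, x_ 1 <= x <= x_ 4 & D x = 0.
  have [yz|zy] := leP y z.
  - have [||x] := @IVT _ D y z 0 yz; first exact: continuous_subspaceT.
      by rewrite ge_min Dy le_max Dz orbT.
    rewrite in_itv /= => /andP[yx' xz] Dx; exists x => //.
    by move: yx zx => /andP[? ?] /andP[? ?]; apply/andP; split; lra.
  - have [||x] := @IVT _ D z y 0 (ltW zy); first exact: continuous_subspaceT.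
      by rewrite ge_min Dy le_max Dz orbT.
    rewrite in_itv /= => /andP[yx' xz] Dx; exists x => //.
    by move: yx zx => /andP[? ?] /andP[? ?]; apply/andP; split; lra.
have [wk Ek] := ab _ xyz.
have Mx : M%:R <= x by move: xyz => /andP[+ _]; exact/le_trans/x0.
have De : sigma * bE N M x * bw a (x / kappa) = bw a x * bE N M (x / kappa).
  exact/subr0_eq.
have Mgt0 : 0 < M%:R :> R by rewrite ltr0n.
exists x; split=> //.
  by rewrite Mx /= -x4E; move: xyz => /andP[].
(* [bw] and its derivative cannot vanish together. *)
apply/eqP => wx.
have [wM _] : 0 < bw a M%:R /\ 0 <= bE N M M%:R by apply: below; rewrite lexx ltW.
have cE' : 2 * M%:R + (N%:R - 2) + 1 = (2 * M + N - 1)%:R :> R.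
  by rewrite natrB ?addn_gt0 ?(ltnW N1) ?orbT// natrD natrM; ring.
have /negP := @ode_nonvanishing _ _ _ _ _ (fun y => is_derive_bw y a1)
  (fun y => is_derive_bw1 y a1) (fun y => order_of_ode M y N1)
  _ _ _ cE' Mgt0 Mx (lt0r_neq0 wM) wx; apply.
move/eqP: De; rewrite wx mul0r /bE -/a wx mulr0 add0r.
rewrite !mulf_eq0 (gt_eqF s0) (gt_eqF wk) orbF /= gt_eqF//.
exact: lt_le_trans Mx.
Unshelve. all: by end_near. Qed.

End roots.

(** * A smooth cut-off *)

Section flat.
Context {R : realType}.
Implicit Types (p : {poly R}) (t y : R).

Lemma exprn_expRN_le (n : nat) y : 0 <= y -> y ^+ n * expR (- y) <= n`!%:R.
Proof.
move=> y0; rewrite expRN ler_pdivrMr ?expR_gt0//.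
have f0 : 0 < n`!%:R :> R by rewrite ltr0n fact_gt0.
rewrite -ler_pdivrMl// mulrC.
case: n f0 => [|n] _.
  by rewrite expr0 fact0 invr1 mul1r (le_trans _ (expR_ge1Dx y))// lerDl.
by rewrite (le_trans _ (expR_ge1Dxn n y0))// lerDr.
Qed.

Lemma horner_expRN_bounded p :
  exists2 C : R, 0 <= C & forall y, 0 <= y -> `|p.[y]| * expR (- y) <= C.
Proof.
exists (\sum_(i < size p) `|p`_i| * i`!%:R).
  by apply: sumr_ge0 => i _; rewrite mulr_ge0.
move=> y y0; rewrite horner_coef.
apply: (@le_trans _ _ ((\sum_(i < size p) `|p`_i * y ^+ i|) * expR (- y))).
  by rewrite ler_wpM2r ?expR_ge0// ler_norm_sum.
rewrite mulr_suml ler_sum// => i _.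
rewrite normrM normrX (ger0_norm y0) -mulrA ler_wpM2l//.
exact: exprn_expRN_le.
Qed.

(** These functions are closed under differentiation, see [is_derive_flat], so
    that each of them is smooth; they vanish to infinite order at 0. *)
Definition flat p t : R := if 0 < t then p.[t^-1] * expR (- t^-1) else 0.

Definition dflat p : {poly R} := 'X^2 * (p - p^`()).

Lemma flat_le0 p t : t <= 0 -> flat p t = 0.
Proof. by rewrite /flat leNgt => /negbTE ->. Qed.

Lemma flat_bounded p : exists2 C : R, 0 <= C & forall t, `|flat p t| <= C.
Proof.
have [C C0 pC] := horner_expRN_bounded p; exists C => // t; rewrite /flat.
case: ifPn => [t0|]; last by rewrite normr0.
by rewrite normrM [`|expR _|]ger0_norm ?expR_ge0// pC// invr_ge0 ltW.
Qed.

Lemma flat_sqr_bounded p : exists2 C : R, 0 <= C & forall t, `|flat p t| <= C * t ^+ 2.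
Proof.
have [C C0 pC] := flat_bounded (p * 'X^2); exists C => // t.
case: (leP t 0) => [t0|t0]; first by rewrite flat_le0// normr0 mulr_ge0// sqr_ge0.
rewrite -ler_pdivrMr ?exprn_gt0//; apply: le_trans (pC t).
rewrite /flat t0 hornerM hornerXn mulrAC [leRHS]normrM.
by rewrite (ger0_norm (sqr_ge0 t^-1)) exprVn.
Qed.

Lemma is_derive_flat p t : is_derive t 1 (flat p) (flat (dflat p) t).
Proof.
have [t0|t0|->] := ltrgtP t 0.
- rewrite [flat (dflat p) t]flat_le0 ?ltW//.
  have cst0 := is_derive_cst (0 : R) t (1 : R).
  apply: near_eq_is_derive cst0; near=> y; rewrite flat_le0//; apply: ltW; near: y; exact: lt_nbhsl.
- pose f y := p.[y^-1] * expR (- y^-1).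
  suff fd : is_derive t 1 f (flat (dflat p) t).
    apply: near_eq_is_derive fd; near=> y.
    by rewrite /flat ifT//; near: y; exact: lt_nbhsr.
  have tn0 : t != 0 by rewrite gt_eqF.
  have dV := @is_deriveV _ id t 1 1 tn0 (is_derive_id _ _).
  have dVN := is_derive_scalef (-1) dV.
  have := is_derive_mulf
    (@is_derive_compf _ _ (horner p) (fun y => y^-1) t 1 _ _ (is_derive_poly _ _) dV)
    (@is_derive_compf _ _ expR (fun y => -1 * y^-1) t 1 _ _ (is_derive_expR _) dVN).
  have -> : (fun y => p.[y^-1] * expR (-1 * y^-1)) = f.
    by apply/funext => y; rewrite /f mulN1r.
  move/is_derive_eq; apply; rewrite /flat t0 /dflat hornerM hornerXn hornerD hornerN.
  by rewrite mulN1r [_ *: 1]mulr1 exprVn; ring.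
rewrite [flat (dflat p) 0]flat_le0//.
have [C C0 pC] := flat_sqr_bounded p.
have C1 : 0 < C + 1 by rewrite ltr_wpDl.
have cv : h^-1 *: (flat p (h *: 1 + 0) - flat p 0) @[h --> 0^'] --> (0 : R).
  apply/cvgrPdist_le => e e0; near=> h.
  have hn0 : h != 0 by near: h; exact: nbhs_dnbhs_neq.
  rewrite sub0r normrN addr0 [h *: 1]mulr1 [flat p 0]flat_le0// subr0.
  rewrite normrM normfV ler_pdivrMl ?normr_gt0//.
  rewrite (le_trans (pC h))// -real_normK ?num_real// expr2 mulrA [leRHS]mulrC ler_pM2r ?normr_gt0//.
  rewrite (@le_trans _ _ ((C + 1) * `|h|))//; first by rewrite ler_wpM2r// lerDl.
  rewrite -ler_pdivlMl//; near: h; apply: dnbhs0_le.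
  by rewrite mulr_gt0 ?invr_gt0.
apply: DeriveDef; first by apply/cvg_ex; exists 0.
exact: cvg_lim cv.
Unshelve. all: by end_near. Qed.

End flat.

(** * Smooth functions of several variables *)

Section continuous_fun.
Context {R : realType} {T : topologicalType}.
Implicit Types f g : T -> R.

Lemma continuous_addf f g :
  continuous f -> continuous g -> continuous (fun x => f x + g x).
Proof. by move=> cf cg x; apply: cvgD; [exact: cf | exact: cg]. Qed.

Lemma continuous_mulf f g :
  continuous f -> continuous g -> continuous (fun x => f x * g x).
Proof. by move=> cf cg x; apply: cvgM; [exact: cf | exact: cg]. Qed.

Lemma continuous_compf (h : R -> R) f :
  continuous h -> continuous f -> continuous (fun x => h (f x)).
Proof. by move=> ch cf x; apply: continuous_comp; [exact: cf | exact: ch]. Qed.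

End continuous_fun.

Section smooth.
Context {R : realType} {N : nat}.
Local Notation V := 'rV[R]_N.
Implicit Types (f g : V -> R) (x : V) (i j : 'I_N).

Definition unit_vec i : V := delta_mx ord0 i.

Lemma is_derive_line f x v d :
  is_derive (0 : R) 1 (fun t : R => f (t *: v + x)) d -> is_derive x v f d.
Proof.
move=> [fd fE]; apply: DeriveDef; first exact: (derivable1P _ _ _).2.
rewrite -fE /derive; set g1 := fun h => h^-1 *: _; set g2 := fun h => h^-1 *: _.
suff -> : g1 = g2 by [].
apply/funext => t; rewrite /g1 /g2 /=.
by rewrite addr0 [_ *: 1]mulr1 scale0r add0r.
Qed.

Lemma pderive_val i f x d : is_derive x (unit_vec i) f d -> pderive i f x = d.
Proof. by case=> _ <-. Qed.

Lemma pderive_ext i f (df : V -> R) :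
  (forall x, is_derive x (unit_vec i) f (df x)) -> pderive i f = df.
Proof. by move=> fd; apply/funext => x; exact: pderive_val. Qed.

Lemma Cr_continuous r f : Cr r f -> continuous f.
Proof. by case: r => [|r []]. Qed.

Lemma CrS r f : Cr r.+1 f -> Cr r f.
Proof.
elim: r f => [|r ih] f; first by case.
by case=> cf df Cf; split => // i; exact: ih.
Qed.

Lemma Cr_is_derive r f x i : Cr r.+1 f -> is_derive x (unit_vec i) f (pderive i f x).
Proof. by case=> _ df _; exact: derivableP. Qed.

Lemma Cr_pderive r f i : Cr r.+1 f -> Cr r (pderive i f).
Proof. by case=> _ _; apply. Qed.

Lemma Cr_intro r f (df : 'I_N -> V -> R) : continuous f ->
  (forall i x, is_derive x (unit_vec i) f (df i x)) ->
  (forall i, Cr r (df i)) -> Cr r.+1 f.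
Proof.
move=> cf fd Cdf; split; first exact: cf.
  by move=> i x; case: (fd i x).
by move=> i; rewrite (pderive_ext (fd i)).
Qed.

Lemma Cr_cst r (c : R) : Cr r (fun _ : V => c).
Proof.
elim: r c => [|r ih] c; first exact: cst_continuous.
apply: (@Cr_intro _ _ (fun _ _ => 0) _ (fun i x => is_derive_cst c x _)) => [x|i].
  exact: cst_continuous.
exact: ih.
Qed.

Lemma Cr_add r f g : Cr r f -> Cr r g -> Cr r (fun x => f x + g x).
Proof.
elim: r f g => [|r ih] f g Cf Cg; first by exact: continuous_addf (Cr_continuous Cf) (Cr_continuous Cg).
apply: (Cr_intro (df := fun i x => pderive i f x + pderive i g x) _
  (fun i x => is_derive_addf (Cr_is_derive x i Cf) (Cr_is_derive x i Cg))) => [x|i].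
- exact: continuous_addf (Cr_continuous Cf) (Cr_continuous Cg) x.
- by apply: ih; exact: Cr_pderive.
Qed.

Lemma Cr_mul r f g : Cr r f -> Cr r g -> Cr r (fun x => f x * g x).
Proof.
elim: r f g => [|r ih] f g Cf Cg; first by exact: continuous_mulf (Cr_continuous Cf) (Cr_continuous Cg).
apply: (Cr_intro (df := fun i x => f x * pderive i g x + g x * pderive i f x) _
  (fun i x => is_derive_mulf (Cr_is_derive x i Cf) (Cr_is_derive x i Cg))) => [x|i].
- exact: continuous_mulf (Cr_continuous Cf) (Cr_continuous Cg) x.
- by apply: Cr_add; apply: ih; by [exact: CrS|exact: Cr_pderive].
Qed.

Lemma Cr_comp r (h : nat -> R -> R) n f :
  (forall m (t : R), is_derive t 1 (h m) (h m.+1 t)) -> Cr r f ->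
  Cr r (fun x => h n (f x)).
Proof.
move=> hd; have hc m : continuous (h m) by exact: (continuous_derivable (hd m)).
elim: r n f => [|r ih] n f Cf.
  exact: continuous_compf (hc n) (Cr_continuous Cf).
apply: (Cr_intro (df := fun i x => pderive i f x * h n.+1 (f x)) _
  (fun i x => is_derive_compf (hd n (f x)) (Cr_is_derive x i Cf))) => [x|i].
- exact: continuous_compf (hc n) (Cr_continuous Cf) x.
- by apply: Cr_mul; [exact: Cr_pderive | apply: ih; exact: CrS].
Qed.

Lemma is_derive_coord x i j :
  is_derive x (unit_vec i) (fun y : V => y ord0 j) (i == j)%:R.
Proof.
apply: is_derive_line.
have -> : (fun t : R => (t *: unit_vec i + x) ord0 j) =
    (fun t => (i == j)%:R * t + x ord0 j).
  by apply/funext => t; rewrite !mxE eqxx eq_sym /= mulrC.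
have := is_derive_addf (is_derive_scalef (i == j)%:R (is_derive_id (0 : R) (1 : R)))
  (is_derive_cst (x ord0 j) (0 : R) (1 : R)).
by move/is_derive_eq; apply; rewrite mulr1 addr0.
Qed.

Lemma Cr_coord r j : Cr r (fun x : V => x ord0 j).
Proof.
case: r => [|r]; first exact: coord_continuous.
apply: (Cr_intro _ (fun i x => is_derive_coord x i j)) => [x|i].
- exact: coord_continuous.
- exact: Cr_cst.
Qed.

Lemma smooth_cst (c : R) : smooth (fun _ : V => c).
Proof. by move=> r; exact: Cr_cst. Qed.

Lemma smooth_coord j : smooth (fun x : V => x ord0 j).
Proof. by move=> r; exact: Cr_coord. Qed.

Lemma smooth_add f g : smooth f -> smooth g -> smooth (fun x => f x + g x).
Proof. by move=> Cf Cg r; exact: Cr_add. Qed.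

Lemma smooth_mul f g : smooth f -> smooth g -> smooth (fun x => f x * g x).
Proof. by move=> Cf Cg r; exact: Cr_mul. Qed.

Lemma smooth_scale (c : R) f : smooth f -> smooth (fun x => c * f x).
Proof. by move=> Cf; apply: smooth_mul => //; exact: smooth_cst. Qed.

Lemma smooth_sum I (s : seq I) (F : I -> V -> R) :
  (forall k, smooth (F k)) -> smooth (fun x => \sum_(k <- s) F k x).
Proof.
move=> CF; elim: s => [|k s ih].
  by under eq_fun do rewrite big_nil; exact: smooth_cst.
by under eq_fun do rewrite big_cons; exact: smooth_add.
Qed.

Lemma smooth_comp (h : nat -> R -> R) n f :
  (forall m (t : R), is_derive t 1 (h m) (h m.+1 t)) -> smooth f ->
  smooth (fun x => h n (f x)).
Proof. by move=> hd Cf r; exact: Cr_comp. Qed.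

Lemma smooth_pderive f i : smooth f -> smooth (pderive i f).
Proof. by move=> Cf r; exact: Cr_pderive (Cf r.+1). Qed.

Lemma smooth_continuous f : smooth f -> continuous f.
Proof. by move=> Cf; exact: (Cf 0). Qed.

Lemma smooth_is_derive f x i : smooth f ->
  is_derive x (unit_vec i) f (pderive i f x).
Proof. by move=> Cf; exact: Cr_is_derive (Cf 1). Qed.

Definition norm2 x : R := \sum_i x ord0 i ^+ 2.

Lemma smooth_norm2 : smooth norm2.
Proof. by apply: smooth_sum => i; apply: smooth_mul; exact: smooth_coord. Qed.

Lemma pderive_mul f g i x : smooth f -> smooth g ->
  pderive i (fun y => f y * g y) x = f x * pderive i g x + g x * pderive i f x.
Proof.
move=> Cf Cg; apply: pderive_val.
exact: (is_derive_mulf (smooth_is_derive x i Cf) (smooth_is_derive x i Cg)).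
Qed.

Lemma pderive_comp (h dh : R -> R) f i x : (forall t : R, is_derive t 1 h (dh t)) ->
  smooth f -> pderive i (fun y => h (f y)) x = pderive i f x * dh (f x).
Proof.
move=> hd Cf; apply: pderive_val.
exact: (is_derive_compf (hd (f x)) (smooth_is_derive x i Cf)).
Qed.

Lemma is_derive_sumf I (s : seq I) (F dF : I -> V -> R) x v :
  (forall k, is_derive x v (F k) (dF k x)) ->
  is_derive x v (fun y => \sum_(k <- s) F k y) (\sum_(k <- s) dF k x).
Proof.
move=> Fd; elim: s => [|k s ih].
  by under eq_fun do rewrite big_nil; rewrite big_nil; exact: is_derive_cst.
under eq_fun do rewrite big_cons; rewrite big_cons.
exact: (is_derive_addf (Fd k) ih).
Qed.

Lemma pderive_norm2 i x : pderive i norm2 x = 2 * x ord0 i.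
Proof.
apply: pderive_val.
have := @is_derive_sumf _ (index_enum 'I_N) (fun j y => y ord0 j ^+ 2)
  (fun j y => y ord0 j * (i == j)%:R + y ord0 j * (i == j)%:R) x (unit_vec i).
move=> h; apply: (is_derive_eq (h _)).
  by move=> j; exact: (is_derive_mulf (is_derive_coord x i j) (is_derive_coord x i j)).
rewrite (bigD1 i)//= eqxx big1 => [|j ji]; first by rewrite addr0 mulr1; ring.
by rewrite eq_sym (negbTE ji) mulr0 addr0.
Qed.

End smooth.

(** * Lebesgue measure on row vectors *)

Section rV_measure.
Context {R : realType}.

Lemma continuous_rV (T : topologicalType) N (f : T -> 'rV[R]_N) :
  (forall i, continuous (fun t => f t ord0 i)) -> continuous f.
Proof.
move=> cf t A /nbhs_ballP[e /= e0 eA].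
have : \forall s \near t, forall i, ball (f t ord0 i) e (f s ord0 i).
  by apply: filter_forall => i; apply: (cf i t); exact: nbhsx_ballx.
apply: filterS => s fs; apply: eA; split => // i j.
by rewrite !ord1; exact: fs.
Qed.

Definition box N (c : 'rV[R]_N) (d : R) : set 'rV[R]_N :=
  [set x | forall i, `|x ord0 i - c ord0 i| < d].

Lemma measurable_box N (c : 'rV[R]_N) (d : R) : measurable (box c d).
Proof.
have -> : box c d = \big[setI/setT]_(i < N)
    ((fun x : 'rV[R]_N => x ord0 i) @^-1` `]c ord0 i - d, c ord0 i + d[%classic).
  rewrite -bigcap_seq; apply/seteqP; split => x /= xb.
    by move=> i _ /=; rewrite in_itv /= -ltr_distlC distrC.
  by move=> i; have := xb i; rewrite /= in_itv /= -ltr_distlC distrC; apply;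
    rewrite mem_index_enum.
apply: bigsetI_measurable => i _.
by rewrite -[X in measurable X]setTI; exact: measurable_coord.
Qed.

Lemma rV_cons_ord0 N (t : R) (y : 'rV[R]_N) : rV_cons (t, y) ord0 ord0 = t.
Proof.
have -> : (ord0 : 'I_N.+1) = lshift N (ord0 : 'I_1) by exact/val_inj.
by apply: etrans (row_mxEl _ _ _ _) _; rewrite mxE.
Qed.

Lemma rV_cons_lift N (t : R) (y : 'rV[R]_N) (j : 'I_N) :
  rV_cons (t, y) ord0 (lift ord0 j) = y ord0 j.
Proof.
have -> : lift ord0 j = rshift 1 j by exact/val_inj.
exact: row_mxEr.
Qed.

Lemma rV_uncons_lift N (x : 'rV[R]_N.+1) (j : 'I_N) :
  (rV_uncons x).2 ord0 j = x ord0 (lift ord0 j).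
Proof. by rewrite mxE; congr (x _ _); exact/val_inj. Qed.

Lemma rV_cons_box N (c : 'rV[R]_N.+1) (d : R) :
  rV_cons @^-1` (box c d) =
  [set t : measurableTypeR R | `|t - c ord0 ord0| < d] `*` box (rV_uncons c).2 d.
Proof.
apply/seteqP; split => -[t y] /= => [H|[Ht Hy] i].
  split; first by have := H ord0; rewrite rV_cons_ord0.
  by move=> i; have := H (lift ord0 i); rewrite rV_cons_lift rV_uncons_lift.
case: (unliftP ord0 i) => [j|] ->; last by rewrite rV_cons_ord0.
by have := Hy j; rewrite rV_cons_lift rV_uncons_lift.
Qed.

Lemma lebesgue_rV_box N (c : 'rV[R]_N) (d : R) : 0 < d ->
  lebesgue_rV (box c d) = ((2 * d) ^+ N)%:E.
Proof.
move=> d0; elim: N c => [|N ih] c.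
  by rewrite /= diracE mem_set// => -[].
have -> : lebesgue_rV (box c d) =
  (@lebesgue_measure R \x @lebesgue_rV R N)%E (rV_cons @^-1` box c d) by [].
rewrite rV_cons_box.
have -> : [set t : measurableTypeR R | `|t - c ord0 ord0| < d] =
    `]c ord0 ord0 - d, c ord0 ord0 + d[%classic.
  by apply/seteqP; split => t /=; rewrite in_itv /= -ltr_distlC distrC.
rewrite product_measure1E; [|exact: measurable_itv|exact: measurable_box].
have LE (t : R) : lebesgue_measure (`]t - d, t + d[%classic : set R) = (2 * d)%:E.
  rewrite lebesgue_measure_itv /= lte_fin ifT; last by lra.
  by rewrite -EFinB; congr EFin; ring.
by rewrite ih exprS EFinM; congr (_ * _)%E; exact: LE.
Qed.

(** An open set is the union of the countably many boxes it contains which have a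
    rational centre and a radius [1 / (m + 1)]. *)
Lemma open_measurable_rV N (U : set 'rV[R]_N) : open U -> measurable U.
Proof.
move=> oU.
pose q (z : 'rV[rat]_N * nat) : 'rV[R]_N := map_mx ratr z.1.
pose F (z : 'rV[rat]_N * nat) := box (q z) z.2.+1%:R^-1.
have -> : U = \bigcup_(z in [set z | F z `<=` U]) F z.
  apply/seteqP; split => [x Ux|x [z /= zU]]; last exact: zU.
  have /nbhs_ballP[e /= e0 eU] : nbhs x U by apply: open_nbhs_nbhs.
  have e2 : 0 < e / 2 by rewrite divr_gt0.
  have [m me] : exists m, m.+1%:R^-1 < e / 2 :> R.
    have [m _ /(_ m (leqnn m)) mE] := @near_infty_natSinv_lt R (PosNum e2).
    by exists m.
  have m0 : 0 < m.+1%:R^-1 :> R by rewrite invr_gt0.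
  have /choice[r rP] : forall i, exists r : rat, `|x ord0 i - ratr r| < m.+1%:R^-1.
    move=> i; have [|r] := @rat_in_itvoo R (x ord0 i - m.+1%:R^-1) (x ord0 i + m.+1%:R^-1).
      by rewrite ltrBlDr -addrA ltrDl addr_gt0.
    by rewrite in_itv /= -ltr_distlC => rx; exists r.
  exists (\row_i r i, m); last by move=> i; rewrite /= !mxE.
  move=> y /= yq; apply: eU; split => // i j; rewrite !ord1 {i}.
  rewrite /ball /=; have := yq j; have := rP j; rewrite /= !mxE.
  move: me; move: (m.+1%:R^-1 : R) => s me.
  by rewrite !ltr_distl => /andP[? ?] /andP[? ?]; apply/andP; split; lra.
rewrite bigcup_mkcond; apply: countable_bigcupT_measurable => //.
by move=> z; case: ifP => // _; exact: measurable_box.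
Qed.

Lemma continuous_measurable_rV N (f : 'rV[R]_N -> R) (D : set 'rV[R]_N) :
  continuous f -> measurable D -> measurable_fun D f.
Proof.
move=> cf mD; apply: (@measurable_funS _ _ _ _ setT) => //.
apply: (measurability _ (RGenOpens.measurableE R)).
move=> _ [_ [a [b ->] <-]]; rewrite setTI; apply: open_measurable_rV.
by move/continuousP : cf; apply; exact: interval_open.
Qed.

End rV_measure.

(** * Integration by parts *)

Section ibp.
Context {R : realType}.

Lemma bounded_support_integrable d (T : measurableType d)
    (mu : {measure set T -> \bar R}) (g : T -> R) (B : set T) (C : R) :
  measurable_fun setT g -> measurable B -> (mu B < +oo)%E ->
  (forall x, `|g x| <= C) -> (forall x, ~ B x -> g x = 0) ->
  mu.-integrable setT (EFin \o g).
Proof.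
move=> mg mB Boo gC g0.
have -> : EFin \o g = (EFin \o g) \_ B.
  apply/funext => x; rewrite patchE; case: ifPn => // /negP Bx.
  by rewrite /= g0// => Bx'; apply: Bx; rewrite inE.
apply: (integrable_mkcond _ mB).1; apply: measurable_bounded_integrable => //.
  exact: measurable_funS mg.
exists C; split; first exact: num_real.
by move=> y Cy x _; exact: le_trans (gC x) (ltW Cy).
Qed.

Lemma is_derive_along (V : normedModType R) (f : V -> R) (v z : V) (t d : R) :
  is_derive (t *: v + z) v f d -> is_derive t 1 (fun s : R => f (s *: v + z)) d.
Proof.
move=> [fd fE].
have E : (fun h : R => h^-1 *: (((fun s : R => f (s *: v + z)) \o shift t) (h *: 1)
      - f (t *: v + z))) =
    (fun h => h^-1 *: ((f \o shift (t *: v + z)) (h *: v) - f (t *: v + z))).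
  by apply/funext => h /=; rewrite [h *: 1]mulr1 scalerDl addrA.
by apply: DeriveDef; rewrite /derivable /derive E.
Qed.

Lemma rV_cons_addr N (t s : R) (y : 'rV[R]_N) j :
  rV_cons (t, s *: unit_vec j + y) =
  s *: unit_vec (lift ord0 j) + rV_cons (t, y).
Proof.
apply/rowP => k; rewrite [RHS]mxE.
case: (unliftP ord0 k) => [l|] ->.
  by rewrite !rV_cons_lift !mxE (inj_eq lift_inj).
by rewrite !rV_cons_ord0 !mxE eq_liftF andbF mulr0 add0r.
Qed.

Lemma rV_cons_addl N (t : R) (y : 'rV[R]_N) :
  rV_cons (t, y) = t *: unit_vec ord0 + rV_cons (0, y).
Proof.
apply/rowP => k; rewrite [RHS]mxE.
case: (unliftP ord0 k) => [l|] ->.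
  by rewrite !rV_cons_lift !mxE lift_eqF andbF mulr0 add0r.
by rewrite !rV_cons_ord0 !mxE eqxx mulr1 addr0.
Qed.

Lemma continuous_rV_consr N (t : R) : continuous (fun y : 'rV[R]_N => rV_cons (t, y)).
Proof.
apply: continuous_rV => i; case: (unliftP ord0 i) => [j|] ->.
  by under eq_fun do rewrite rV_cons_lift; exact: coord_continuous.
by under eq_fun do rewrite rV_cons_ord0; exact: cst_continuous.
Qed.

Lemma continuous_rV_consl N (y : 'rV[R]_N) : continuous (fun t : R => rV_cons (t, y)).
Proof.
apply: continuous_rV => i; case: (unliftP ord0 i) => [j|] ->.
  by under eq_fun do rewrite rV_cons_lift; exact: cst_continuous.
by under eq_fun do rewrite rV_cons_ord0; move=> t; exact: cvg_id.
Qed.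

Lemma integral_derive_eq0 (f g : R -> R) (M : R) : 0 < M -> continuous g ->
  (forall t : R, is_derive t 1 f (g t)) ->
  (forall t, M <= `|t| -> f t = 0 /\ g t = 0) ->
  (\int[lebesgue_measure]_t (g t)%:E = 0)%E.
Proof.
move=> M0 cg fd fg0.
have cf := continuous_derivable fd.
transitivity (\int[lebesgue_measure]_(t in `[(- M)%R, M]) (g t)%:E)%E.
  rewrite [RHS]integral_mkcond; apply: eq_integral => t _.
  rewrite patchE; case: ifPn => // /negP tM.
  rewrite (fg0 t _).2//; apply: contra_notT tM; rewrite -ltNge => tM.
  by rewrite inE /= in_itv /= -ler_norml ltW.
rewrite (@continuous_FTC2 _ g f) ?gtrN//.
- have [fM _] := fg0 M (ler_norm M).
  have [|fNM _] := fg0 (- M); first by rewrite normrN ler_norm.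
  by rewrite fM fNM subee.
- exact: continuous_subspaceT.
- split; first by move=> t _; case: (fd t).
  + exact/cvg_at_right_filter/cf.
  + exact/cvg_at_left_filter/cf.
- by move=> t _; rewrite derive1E; case: (fd t) => _ ->.
Qed.

(** By Fubini's theorem the variable of differentiation can be integrated first;
    induction on the dimension, splitting off one coordinate at a time, reaches
    it. *)
Lemma integral_pderive_eq0 N (i : 'I_N) (f g : 'rV[R]_N -> R) (M C : R) :
  0 < M -> continuous g -> (forall x, is_derive x (unit_vec i) f (g x)) ->
  (forall x, ~ box 0 M x -> f x = 0 /\ g x = 0) -> (forall x, `|g x| <= C) ->
  (\int[lebesgue_rV]_x (g x)%:E = 0)%E.
Proof.
move=> M0; elim: N i f g => [|N ih] i f g cg fd fg0 gC; first by case: i fd => [].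
pose G := EFin \o (g \o @rV_cons R N).
have mg : measurable_fun setT g by exact: continuous_measurable_rV.
have mG : measurable_fun setT G.
  by apply/measurable_EFinP; apply: measurableT_comp mg _; exact: measurable_rV_cons.
have iG : (@lebesgue_measure R \x @lebesgue_rV R N)%E.-integrable setT G.
  apply: (@bounded_support_integrable _ _ _ (g \o rV_cons) (rV_cons @^-1` box 0 M) C).
  - exact/measurable_EFinP.
  - rewrite -[X in measurable X]setTI; apply: measurable_rV_cons => //.
    exact: measurable_box.
  - have boxoo : (lebesgue_rV (box (0 : 'rV[R]_N.+1) M) < +oo)%E.
      by rewrite lebesgue_rV_box// ltry.
    exact: boxoo.
  - by move=> p; exact: gC.
  - by move=> p pM; exact: (fg0 _ pM).2.
have -> : (\int[lebesgue_rV]_x (g x)%:E =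
    \int[(@lebesgue_measure R \x @lebesgue_rV R N)]_p G p)%E.
  have mEg : measurable_fun setT (EFin \o g) by exact/measurable_EFinP.
  exact: (@integral_pushforward _ _ _ _ _ _ (@measurable_rV_cons R N)
    (@lebesgue_measure R \x @lebesgue_rV R N)%E setT (EFin \o g) mEg iG measurableT).
case: (unliftP ord0 i) => [j|] iE.
  rewrite -integral12_prod_meas1//; apply: integral0_eq => t _.
  apply: (ih j (fun y => f (rV_cons (t, y))) (fun y => g (rV_cons (t, y)))).
  - move=> y; apply: continuous_comp; [exact: continuous_rV_consr|exact: cg].
  - move=> y; apply: is_derive_line.
    have -> : (fun s : R => f (rV_cons (t, s *: unit_vec j + y))) =
        (fun s : R => f (s *: unit_vec (lift ord0 j) + rV_cons (t, y))).
      by apply/funext => s; rewrite rV_cons_addr.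
    by apply: is_derive_along; rewrite scale0r add0r -iE.
  - move=> y yM; apply: fg0 => H; apply: yM => k.
    by have := H (lift ord0 k); rewrite rV_cons_lift !mxE.
  - by [].
rewrite -integral21_prod_meas1//; apply: integral0_eq => y _.
apply: (@integral_derive_eq0 (fun t => f (rV_cons (t, y))) (fun t => g (rV_cons (t, y))) M) => //.
- move=> t; apply: continuous_comp; [exact: continuous_rV_consl|exact: cg].
- move=> t.
  have -> : (fun s : R => f (rV_cons (s, y))) =
      (fun s : R => f (s *: unit_vec ord0 + rV_cons (0, y))).
    by apply/funext => s; rewrite rV_cons_addl.
  by apply: is_derive_along; rewrite -rV_cons_addl -iE.
- move=> t Mt; apply: fg0 => /(_ ord0); rewrite rV_cons_ord0 mxE subr0.
  by rewrite ltNge Mt.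
Qed.

End ibp.

(** * Smooth functions on the unit ball *)

Section Rintegral_sum.
Context d (T : measurableType d) (R : realType) (mu : {measure set T -> \bar R}).
Variables (D : set T) (mD : measurable D).

Lemma Rintegral_sum I (s : seq I) (F : I -> T -> R) :
  (forall k, mu.-integrable D (EFin \o F k)) ->
  mu.-integrable D (EFin \o (fun x => \sum_(k <- s) F k x)) /\
  \int[mu]_(x in D) (\sum_(k <- s) F k x) = \sum_(k <- s) \int[mu]_(x in D) F k x.
Proof.
move=> iF; elim: s => [|k s [sumi IH]].
  rewrite big_nil; under eq_Rintegral do rewrite big_nil.
  split; last by rewrite Rintegral_cst// mul0r.
  by under eq_fun do rewrite big_nil; exact: integrable0.
split.
  have := integrableD mD (iF k) sumi; apply: eq_integrable => // x _ /=.
  by rewrite big_cons EFinD.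
rewrite big_cons -IH -RintegralD//.
by apply: eq_Rintegral => x _; rewrite big_cons.
Qed.

End Rintegral_sum.

Section ball.
Context {R : realType} {N : nat}.
Local Notation V := 'rV[R]_N.
Local Notation mu := (@lebesgue_rV R N).
Implicit Types (f g u : V -> R) (x : V) (i j : 'I_N).

Lemma norm2_ge0 x : 0 <= norm2 x.
Proof. by apply: sumr_ge0 => i _; exact: sqr_ge0. Qed.

Lemma enorm_sqr x : enorm x ^+ 2 = norm2 x.
Proof. by rewrite sqr_sqrtr// norm2_ge0. Qed.

Lemma eballE r : 0 < r -> eball r = [set x : V | norm2 x < r ^+ 2].
Proof.
move=> r0; apply/seteqP; split => x; rewrite /eball /= -enorm_sqr => xr.
  by rewrite ltrXn2r// ?nnegrE ?sqrtr_ge0// ltW.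
by rewrite -(@ltr_pXn2r _ 2)// ?nnegrE ?sqrtr_ge0// ltW.
Qed.

Lemma open_eball r : 0 < r -> open (eball r : set V).
Proof.
move=> r0; rewrite eballE//.
have /continuousP := smooth_continuous (@smooth_norm2 R N).
by move=> /(_ [set t | t < r ^+ 2]); apply; exact: open_lt.
Qed.

Lemma measurable_eball r : 0 < r -> measurable (eball r : set V).
Proof. by move=> r0; apply: open_measurable_rV; exact: open_eball. Qed.

Lemma coord_sqr_le i x : x ord0 i ^+ 2 <= norm2 x.
Proof.
rewrite /norm2 (bigD1 i)//= lerDl sumr_ge0// => j _; exact: sqr_ge0.
Qed.

Lemma coord_le1 i x : norm2 x <= 1 -> `|x ord0 i| <= 1.
Proof.
move=> x1; rewrite -(@ler_pXn2r _ 2)// ?nnegrE// expr1n.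
by rewrite real_normK ?num_real// (le_trans (coord_sqr_le i x)).
Qed.

Lemma eball_box : eball 1 `<=` box (0 : V) 1.
Proof.
rewrite eballE// => x /=; rewrite expr1n => x1 i; rewrite mxE subr0.
rewrite -(@ltr_pXn2r _ 2)// ?nnegrE// expr1n.
by rewrite real_normK ?num_real// (le_lt_trans (coord_sqr_le i x)).
Qed.

Lemma eball_lty : (mu (eball 1) < +oo)%E.
Proof.
apply: (@le_lt_trans _ _ (mu (box 0 1))).
  apply: le_measure; rewrite ?inE; [|exact: measurable_box|exact: eball_box].
  exact: measurable_eball.
by rewrite lebesgue_rV_box// ltry.
Qed.

Lemma compact_unit_box :
  compact [set v : V | forall i, v ord0 i \in `[(-1 : R), (1 : R)]].
Proof.
apply: (@rV_compact _ _ (fun=> `[(-1 : R), (1 : R)]%classic)).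
by move=> _; exact: segment_compact.
Qed.

Lemma cball_bounded f : continuous f ->
  exists2 C : R, 0 <= C & forall x, norm2 x <= 1 -> `|f x| <= C.
Proof.
move=> cf.
have : compact (f @` [set v : V | forall i, v ord0 i \in `[(-1 : R), (1 : R)]]).
  by apply: continuous_compact compact_unit_box; exact: continuous_subspaceT.
move=> /compact_bounded[M [_ Mf]]; exists (`|M| + 1); first by rewrite addr_ge0.
move=> x x1; apply: (Mf (`|M| + 1)); first by rewrite (le_lt_trans (ler_norm _))// ltrDl.
by exists x => // i; rewrite in_itv /= -ler_norml coord_le1.
Qed.

Lemma eball_norm2_le x : eball 1 x -> norm2 x <= 1.
Proof. by rewrite eballE//= expr1n => /ltW. Qed.

Lemma integrable_eball f : continuous f -> mu.-integrable (eball 1) (EFin \o f).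
Proof.
move=> cf; have mB := measurable_eball ltr01.
apply: measurable_bounded_integrable => //; first exact: eball_lty.
  exact: continuous_measurable_rV.
have [C C0 fC] := cball_bounded cf; exists C; split; first exact: num_real.
move=> y Cy x /eball_norm2_le x1; exact: le_trans (fC _ x1) (ltW Cy).
Qed.

Lemma pderive_eq0 f i (K : set V) : closed K -> (forall x, ~ K x -> f x = 0) ->
  forall x, ~ K x -> pderive i f x = 0.
Proof.
move=> cK f0 x Kx.
have : \forall y \near x, f y = 0.
  have : nbhs x (~` K) by apply: open_nbhs_nbhs; split => //; exact: closed_openC.
  by apply: filterS => y; exact: f0.
move=> /(@near_eq_derive _ _ _ f (cst 0) x (unit_vec i)).
by rewrite /pderive => ->; rewrite derive_cst.
Qed.

Lemma Rintegral_pderive_eq0 f i (K : set V) : Cr 1 f -> compact K ->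
  K `<=` eball 1 -> (forall x, ~ K x -> f x = 0) ->
  \int[mu]_(x in eball 1) pderive i f x = 0.
Proof.
move=> Cf cK KB f0; have clK : closed K by apply: compact_closed cK; exact: norm_hausdorff.
have cg : continuous (pderive i f) := Cr_continuous (Cr_pderive i Cf).
have g0 x : ~ K x -> pderive i f x = 0 by exact: (pderive_eq0 _ clK).
have [C C0 gC] := cball_bounded cg.
have gC' x : `|pderive i f x| <= C.
  have [Kx|Kx] := pselect (K x); first exact/gC/eball_norm2_le/KB.
  by rewrite g0// normr0.
have fg0 x : ~ box 0 1 x -> f x = 0 /\ pderive i f x = 0.
  by move=> xB; split; [apply: f0|apply: g0] => /KB/eball_box.
have E := integral_pderive_eq0 ltr01 cg (fun x => Cr_is_derive x i Cf) fg0 gC'.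
rewrite /Rintegral integral_mkcond -[RHS]/(fine 0) -E; congr fine.
apply: eq_integral => x _; rewrite patchE; case: ifPn => // /negP xB /=.
by rewrite g0// => /KB xB'; apply: xB; rewrite inE.
Qed.

Lemma test_function_mul f phi : smooth f -> test_function (eball 1) phi ->
  test_function (eball 1) (fun x => f x * phi x).
Proof.
move=> Cf [Cphi [K [cK KB phi0]]]; split; first exact: smooth_mul.
by exists K; split => // x /phi0 ->; rewrite mulr0.
Qed.

Lemma test_function_ibp f phi i : smooth f -> test_function (eball 1) phi ->
  \int[mu]_(x in eball 1) (f x * pderive i phi x) =
  - \int[mu]_(x in eball 1) (pderive i f x * phi x).
Proof.
move=> Cf tphi; have Cphi := tphi.1.
have [CF [K [cK KB F0]]] := test_function_mul Cf tphi.
apply/eqP; rewrite -addr_eq0 -RintegralD; first last.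
- apply: integrable_eball; apply: continuous_mulf; apply: smooth_continuous => //.
  exact: smooth_pderive.
- apply: integrable_eball; apply: continuous_mulf; apply: smooth_continuous => //.
  exact: smooth_pderive.
- exact: measurable_eball.
rewrite -[X in _ == X](Rintegral_pderive_eq0 i (CF 1) cK KB F0).
by apply/eqP; apply: eq_Rintegral => x _; rewrite pderive_mul// [_ * phi x]mulrC.
Qed.

Lemma L2norm_sqrt (U : set V) f : measurable U ->
  mu.-integrable U (EFin \o (fun x => f x ^+ 2)) ->
  L2norm U f = (Num.sqrt (\int[mu]_(x in U) f x ^+ 2))%:E.
Proof.
move=> mU iU; rewrite /L2norm unlock.
have -> : (\int[mu]_x `|(EFin \o f \_ U) x| `^ 2 =
    (\int[mu]_(x in U) f x ^+ 2)%:E)%E.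
  rewrite /Rintegral fineK; last exact: integrable_fin_num.
  rewrite [RHS]integral_mkcond; apply: eq_integral => x _ /=.
  rewrite /= !patchE; case: ifPn => _ /=; last by rewrite normr0 powR0.
  by rewrite powR_mulrn// real_normK ?num_real.
rewrite poweR_EFin powR12_sqrt// Rintegral_ge0// => x _; exact: sqr_ge0.
Qed.

Lemma L2_of_integrable (U : set V) f : measurable U -> measurable_fun U f ->
  mu.-integrable U (EFin \o (fun x => f x ^+ 2)) -> L2 U f.
Proof.
move=> mU mf iU; rewrite /L2 inE; apply/andP; split; rewrite inE /=.
  exact: (measurable_restrictT _ mU).1.
have := L2norm_sqrt mU iU; rewrite /L2norm /finite_norm => ->; exact: ltry.
Qed.

Lemma L2_continuous f : continuous f -> L2 (eball 1) f.
Proof.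
move=> cf; have mB := measurable_eball ltr01; apply: L2_of_integrable => //.
  exact: continuous_measurable_rV.
by apply: integrable_eball; exact: continuous_mulf.
Qed.

Lemma L2_measurable (U : set V) f : measurable U -> L2 U f -> measurable_fun U f.
Proof.
move=> mU; rewrite /L2 inE => /andP[]; rewrite inE /= => mf _.
exact: (measurable_restrictT _ mU).2.
Qed.

Lemma L2_integrable f : L2 (eball 1) f -> mu.-integrable (eball 1) (EFin \o f).
Proof.
move=> Lf; have mB := measurable_eball ltr01.
have mf := L2_measurable mB Lf.
have i2 : mu.-integrable (eball 1) (EFin \o (fun x => f x ^+ 2)).
  have := Lfun2_integrable_sqr Lf => /(integrableS measurableT mB (@subsetT _ _)).
  by apply: eq_integrable => // x xB /=; rewrite patchE xB.
have i1 : mu.-integrable (eball 1) (EFin \o (fun x => 1 + f x ^+ 2)).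
  have ic : mu.-integrable (eball 1) (EFin \o (fun _ : V => 1 : R)).
    exact/integrable_eball/cst_continuous.
  by have := integrableD mB ic i2; apply: eq_integrable.
apply: le_integrable i1 => //; first exact/measurable_EFinP.
move=> x _; rewrite /= lee_fin [leRHS]ger0_norm ?addr_ge0 ?sqr_ge0//.
rewrite -[f x ^+ 2]real_normK ?num_real//.
(* [t <= 1 + t^2] *)
by have := sqr_ge0 (`|f x| - 2^-1); nra.
Qed.

Lemma integrable_mul_continuous f g : continuous g ->
  mu.-integrable (eball 1) (EFin \o f) ->
  mu.-integrable (eball 1) (EFin \o (fun x => f x * g x)).
Proof.
move=> cg iF; have mB := measurable_eball ltr01.
have [C C0 gC] := cball_bounded cg.
have bg : [bounded g x | x in eball 1].
  exists C; split; first exact: num_real.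
  move=> y Cy x /eball_norm2_le x1; exact: le_trans (gC _ x1) (ltW Cy).
have := integrableMr mB (continuous_measurable_rV cg mB) bg iF.
by apply: eq_integrable => // x _ /=; rewrite mulrC.
Qed.

Lemma smooth_H1 f : smooth f -> H1 (eball 1) f (grad f).
Proof.
move=> Cf; split; first exact/L2_continuous/smooth_continuous.
  move=> i; under eq_fun do rewrite mxE.
  exact/L2_continuous/smooth_continuous/smooth_pderive.
move=> i phi tphi; under [in RHS]eq_Rintegral do rewrite mxE.
exact: test_function_ibp.
Qed.

Lemma smooth_weak_div (F : V -> V) f : (forall i, smooth (fun x => F x ord0 i)) ->
  (forall x, f x = \sum_i pderive i (fun y => F y ord0 i) x) ->
  weak_div (eball 1) F f.
Proof.
move=> CF fE phi tphi; have Cphi := tphi.1; have mB := measurable_eball ltr01.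
have i1 i : mu.-integrable (eball 1) (EFin \o (fun x => F x ord0 i * pderive i phi x)).
  by apply: integrable_eball; apply: continuous_mulf; apply: smooth_continuous;
    [exact: CF|exact: smooth_pderive].
have i2 i : mu.-integrable (eball 1)
    (EFin \o (fun x => pderive i (fun y => F y ord0 i) x * phi x)).
  by apply: integrable_eball; apply: continuous_mulf; apply: smooth_continuous;
    [exact/smooth_pderive/CF|].
have [_ E1] := Rintegral_sum mB (index_enum 'I_N) i1.
have [_ E2] := Rintegral_sum mB (index_enum 'I_N) i2.
transitivity (\sum_i \int[mu]_(x in eball 1) (F x ord0 i * pderive i phi x)).
  by rewrite -E1; apply: eq_Rintegral => x _; apply: eq_bigr => i _; rewrite mxE.
under eq_bigr do rewrite test_function_ibp//.
rewrite sumrN -E2; congr (- _); apply: eq_Rintegral => x _.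
by rewrite fE mulr_suml.
Qed.

End ball.

(** * Green's formula without boundary integrals *)

Section flat_limits.
Context {R : realType}.
Implicit Types (p : {poly R}) (s t : R).

Lemma cvg_flat p s : 0 < s -> flat p (j.+1%:R * s - 1) @[j --> \oo] --> p.[0].
Proof.
move=> s0; pose f (y : R) := p.[y] * expR (- y).
have cf : continuous f.
  apply: continuous_mulf; first exact: continuous_horner.
  apply: (@continuous_compf _ _ expR (fun y : R => - y)); first exact: continuous_expR.
  exact: oppr_continuous.
have uoo : j.+1%:R * s - 1 @[j --> \oo] --> +oo.
  apply/cvgryPge => A; near=> j; rewrite lerBrDr -ler_pdivrMr//.
  rewrite (@le_trans _ _ j%:R)// ?ler_nat//.
  near: j; exact: nbhs_infty_ger.
have u0 : (j.+1%:R * s - 1)^-1 @[j --> \oo] --> (0 : R).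
  apply/gtr0_cvgV0 => //.
  by near=> j; near: j; apply: (cvgryPgt _).1 uoo 0.
have -> : p.[0] = f 0 by rewrite /f oppr0 expR0 mulr1.
have : f ((j.+1%:R * s - 1)^-1) @[j --> \oo] --> f 0.
  exact: (cvg_comp _ _ u0 (cf 0)).
apply: cvg_trans; apply: near_eq_cvg; near=> j.
rewrite /flat ifT//; near: j; exact: (cvgryPgt _).1 uoo 0.
Unshelve. all: by end_near. Qed.

Lemma dflat1 : dflat (1 : {poly R}) = 'X^2.
Proof. by rewrite /dflat derivC subr0 mulr1. Qed.

(** The gradient of a cut-off at distance [1 / m] from the sphere is of the order of
    [m] times a function of [t = m s], where [s = 1 - |x|^2]; against a field whose
    normal component is of the order of [s] there only remains a function of [t]
    which is bounded and vanishes at infinity. *)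
Lemma mul_flat_sqr t : t * flat 'X^2 (t - 1) = flat ('X + 'X^2) (t - 1).
Proof.
rewrite /flat; case: ifPn => [t1|_]; last by rewrite mulr0.
rewrite hornerD !hornerXn hornerX exprVn; field; lra.
Qed.

Definition iter_dflat p (m : nat) : {poly R} := iter m (@dflat R) p.

Lemma is_derive_iter_dflat p m t :
  is_derive t 1 (flat (iter_dflat p m)) (flat (iter_dflat p m.+1) t).
Proof. exact: is_derive_flat. Qed.

End flat_limits.

Section green.
Context {R : realType} {N : nat}.
Local Notation V := 'rV[R]_N.
Local Notation mu := (@lebesgue_rV R N).
Implicit Types (f g u : V -> R) (x : V) (i j : 'I_N).

Lemma smooth_flat (p : {poly R}) f : smooth f -> smooth (fun x => flat p (f x)).
Proof. exact: (@smooth_comp R N (fun m => flat (iter_dflat p m)) 0 f (@is_derive_iter_dflat R p)). Qed.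

Lemma smooth_sub f g : smooth f -> smooth g -> smooth (fun x => f x - g x).
Proof.
move=> Cf Cg; under eq_fun do rewrite -mulN1r.
exact/smooth_add/smooth_scale.
Qed.

Lemma pderive_sub f g i x : smooth f -> smooth g ->
  pderive i (fun y => f y - g y) x = pderive i f x - pderive i g x.
Proof.
move=> Cf Cg; apply: pderive_val.
exact: (is_deriveB (smooth_is_derive x i Cf) (smooth_is_derive x i Cg)).
Qed.

Lemma pderive_scale (c : R) f i x : smooth f ->
  pderive i (fun y => c * f y) x = c * pderive i f x.
Proof.
move=> Cf; apply: pderive_val.
exact: (is_derive_scalef c (smooth_is_derive x i Cf)).
Qed.

Lemma compact_norm2_le (r : R) : r <= 1 -> compact [set x : V | norm2 x <= r].
Proof.
move=> r1; apply: subclosed_compact compact_unit_box _ => [|x /= xr i].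
  have := smooth_continuous (@smooth_norm2 R N).
  by move=> /continuous_closedP /(_ [set t | t <= r]); apply; exact: closed_le.
by rewrite in_itv /= -ler_norml coord_le1// (le_trans xr).
Qed.

(** Cut-off equal to 0 near the sphere and tending to 1 inside; it is radial, so
    that its gradient only sees the normal component of a field. *)
Definition cutoff (m : nat) x : R := flat 1 (m.+1%:R * (1 - norm2 x) - 1).

Let inner (m : nat) x : R := m.+1%:R * (1 - norm2 x) - 1.

Let smooth_inner m : smooth (inner m).
Proof.
apply: smooth_sub; last exact: smooth_cst.
apply: smooth_scale; apply: smooth_sub; first exact: smooth_cst.
exact: smooth_norm2.
Qed.

Lemma smooth_cutoff m : smooth (cutoff m).
Proof. exact: (smooth_flat 1 (smooth_inner m)). Qed.

Lemma pderive_cutoff m i x : pderive i (cutoff m) x =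
  - 2 * x ord0 i * m.+1%:R * flat 'X^2 (m.+1%:R * (1 - norm2 x) - 1).
Proof.
have := @pderive_comp R N (flat 1) (flat (dflat 1)) (inner m) i x
  (is_derive_flat 1) (smooth_inner m).
rewrite dflat1 => ->.
have C1 : smooth (fun y : V => 1 - norm2 y).
  by apply: smooth_sub; [exact: smooth_cst | exact: smooth_norm2].
rewrite pderive_sub; [|exact: smooth_scale|exact: smooth_cst].
rewrite pderive_scale// pderive_sub; [|exact: smooth_cst|exact: smooth_norm2].
rewrite pderive_norm2 !(pderive_val (is_derive_cst _ _ _)) /inner.
by rewrite !sub0r subr0; ring.
Qed.

Lemma test_function_cutoff m f : smooth f ->
  test_function (eball 1) (fun x => f x * cutoff m x).
Proof.
move=> Cf; apply: test_function_mul => //; split; first exact: smooth_cutoff.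
have m0 : 0 < m.+1%:R :> R by rewrite ltr0n.
exists [set x : V | norm2 x <= 1 - m.+1%:R^-1]; split.
- by apply: compact_norm2_le; rewrite gerBl invr_ge0 ltW.
- move=> x /= xm; rewrite eballE//= expr1n; apply: le_lt_trans xm _.
  by rewrite ltrBlDr ltrDl invr_gt0.
move=> x /negP; rewrite -ltNge => xm; apply: flat_le0.
by rewrite subr_le0 -ler_pdivlMl// mulr1 lerBlDr -lerBlDl ltW.
Qed.

(** The weak gradient of [phi] is tested against [F i] times the cut-off. The error
    [phi (F . grad cutoff)] is bounded by a multiple of [|phi|], because the normal
    component of [F] vanishes on the sphere, and tends to 0 pointwise. *)
Lemma normal_trace_eq0 (F : 'I_N -> V -> R) (C0 : R) (phi : V -> R) (G : V -> V) :
  (forall i, smooth (F i)) ->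
  (forall x, norm2 x <= 1 -> `|\sum_i x ord0 i * F i x| <= C0 * (1 - norm2 x)) ->
  H1 (eball 1) phi G ->
  \int[mu]_(x in eball 1)
    (\sum_i F i x * G x ord0 i + (\sum_i pderive i (F i) x) * phi x) = 0.
Proof.
move=> CF SC [L2phi L2G ibp]; have mB : measurable (eball 1 : set V) := measurable_eball ltr01.
have iphi := L2_integrable L2phi.
have iG i := L2_integrable (L2G i).
pose A x := \sum_i F i x * G x ord0 i + (\sum_i pderive i (F i) x) * phi x.
pose B m x := \sum_i F i x * pderive i (cutoff m) x.
have iA : mu.-integrable (eball 1) (EFin \o A).
  have i1 : mu.-integrable (eball 1) (EFin \o (fun x => \sum_i F i x * G x ord0 i)).
    have iFG i : mu.-integrable (eball 1) (EFin \o (fun x => F i x * G x ord0 i)).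
      have := integrable_mul_continuous (smooth_continuous (CF i)) (iG i).
      by apply: (eq_integrable mB) => x _ /=; rewrite mulrC.
    by have [] := Rintegral_sum mB (index_enum 'I_N) iFG.
  have i2 : mu.-integrable (eball 1)
      (EFin \o (fun x => phi x * \sum_i pderive i (F i) x)).
    apply: integrable_mul_continuous => //; apply: smooth_continuous.
    by apply: smooth_sum => i; exact: smooth_pderive.
  have := integrableD mB i1 i2; apply: (eq_integrable mB) => x _ /=.
  by rewrite /A -EFinD [phi x * _]mulrC.
have cB m : continuous (B m).
  apply: smooth_continuous; apply: smooth_sum => i; apply: smooth_mul => //.
  exact/smooth_pderive/smooth_cutoff.
have if_ m : mu.-integrable (eball 1) (EFin \o (fun x => A x * cutoff m x + phi x * B m x)).
  have i1 := integrable_mul_continuous (smooth_continuous (smooth_cutoff m)) iA.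
  have i2 := integrable_mul_continuous (cB m) iphi.
  by have := integrableD mB i1 i2; apply: (eq_integrable mB).
have int0 m : (\int[mu]_(x in eball 1) (A x * cutoff m x + phi x * B m x)%:E = 0)%E.
  rewrite -[LHS]fineK; last exact: integrable_fin_num (if_ m).
  congr EFin.
  pose psi i x := F i x * cutoff m x.
  have tpsi i : test_function (eball 1) (psi i) by exact: test_function_cutoff.
  have j1 i : mu.-integrable (eball 1) (EFin \o (fun x => phi x * pderive i (psi i) x)).
    apply: integrable_mul_continuous => //; apply: smooth_continuous.
    exact/smooth_pderive/(tpsi i).1.
  have j2 i : mu.-integrable (eball 1) (EFin \o (fun x => G x ord0 i * psi i x)).
    apply: integrable_mul_continuous => //; apply: smooth_continuous.
    exact: (tpsi i).1.
  have j3 i : mu.-integrable (eball 1)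
      (EFin \o (fun x => phi x * pderive i (psi i) x + G x ord0 i * psi i x)).
    by have := integrableD mB (j1 i) (j2 i); apply: (eq_integrable mB).
  have [_ E] := Rintegral_sum mB (index_enum 'I_N) j3.
  transitivity (\int[mu]_(x in eball 1)
    (\sum_i (phi x * pderive i (psi i) x + G x ord0 i * psi i x))).
    apply: eq_Rintegral => x _; rewrite /A /B !mulrDl !mulr_suml mulr_sumr -!big_split /=.
    apply: eq_bigr => i _; rewrite /psi pderive_mul//; last exact: smooth_cutoff.
    by ring.
  rewrite E big1// => i _; rewrite RintegralD// (ibp _ _ (tpsi i)).
  by rewrite addNr.
have BE m x : B m x = - 2 * m.+1%:R * flat 'X^2 (m.+1%:R * (1 - norm2 x) - 1) *
    \sum_i x ord0 i * F i x.
  rewrite /B mulr_sumr; apply: eq_bigr => i _; rewrite pderive_cutoff; ring.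
have Bq m x : norm2 x <= 1 ->
    `|B m x| <= 2 * C0 * `|flat ('X + 'X^2) (m.+1%:R * (1 - norm2 x) - 1)|.
  move=> x1; rewrite BE normrM.
  apply: le_trans (ler_wpM2l (normr_ge0 _) (SC x x1)) _.
  rewrite -mul_flat_sqr !normrM normrN (ger0_norm (ler0n _ m.+1)).
  rewrite (ger0_norm (ler0n _ 2)) [`|1 - _|]ger0_norm ?subr_ge0//.
  by rewrite le_eqVlt; apply/orP; left; apply/eqP; ring.
have [C1 C10 eC1] := flat_bounded (1 : {poly R}).
have [C2 C20 eC2] := flat_bounded ('X + 'X^2 : {poly R}).
have C00 : 0 <= C0.
  have := SC 0; rewrite /norm2 big1 => [|i _]; last by rewrite mxE expr0n.
  by rewrite subr0 mulr1 => /(_ ler01); exact: le_trans.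
have ig : mu.-integrable (eball 1)
    (fun x => (C1 * `|A x| + 2 * C0 * C2 * `|phi x|)%:E).
  have ia := integrableZl mB C1 (integrable_norm iA).
  have ip := integrableZl mB (2 * C0 * C2) (integrable_norm iphi).
  by have := integrableD mB ia ip; apply: (eq_integrable mB).
have mf_ m : measurable_fun (eball 1)
    (fun x => (A x * cutoff m x + phi x * B m x)%:E).
  exact: measurable_int (if_ m).
have mA : measurable_fun (eball 1) (EFin \o A) by exact: measurable_int iA.
have fA : {ae mu, forall x, eball 1 x ->
    (A x * cutoff m x + phi x * B m x)%:E @[m --> \oo] --> (EFin \o A) x}.
  apply: aeW => x xB; have x1 := eball_norm2_le xB.
  apply: cvg_EFin; first by apply: nearW.
  have s0 : 0 < 1 - norm2 x by move: xB; rewrite eballE//= expr1n subr_gt0.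
  have c1 : A x * cutoff m x @[m --> \oo] --> A x * 1.
    by apply: cvgMl_tmp; have := @cvg_flat _ 1 _ s0; rewrite hornerC; exact.
  have c2 : phi x * B m x @[m --> \oo] --> phi x * 0.
    apply: cvgMl_tmp; apply: norm_cvg0; apply: (@squeeze_cvgr _ _ _ _ (fun=> 0)
      (fun m => 2 * C0 * `|flat ('X + 'X^2) (m.+1%:R * (1 - norm2 x) - 1)|)).
    - by apply: nearW => m; rewrite normr_ge0 Bq.
    - exact: cvg_cst.
    - rewrite -[X in _ --> X](mulr0 (2 * C0)); apply: cvgMl_tmp.
      have := cvg_norm (@cvg_flat _ ('X + 'X^2) _ s0).
      by rewrite hornerD hornerX hornerXn expr0n /= addr0 normr0; exact.
  by have := cvgD c1 c2; rewrite mulr1 mulr0 addr0; exact.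
have f_g : {ae mu, forall x m, eball 1 x ->
    (`|(A x * cutoff m x + phi x * B m x)%:E| <=
     (C1 * `|A x| + 2 * C0 * C2 * `|phi x|)%:E)%E}.
  apply: aeW => x m xB; have x1 := eball_norm2_le xB; rewrite lee_fin.
  rewrite (le_trans (ler_normD _ _))// !normrM lerD//.
    by rewrite mulrC ler_wpM2r//; exact: eC1.
  rewrite mulrC ler_wpM2r// (le_trans (Bq m x x1))//.
  by rewrite ler_wpM2l// mulr_ge0.
have [_ _ cv] := dominated_convergence mB mf_ mA fA ig f_g.
rewrite -/(A _) /Rintegral.
have -> : (\int[mu]_(x in eball 1) (A x)%:E = 0)%E; last by [].
have : (fun m => \int[mu]_(x in eball 1) (A x * cutoff m x + phi x * B m x)%:E)%E
    @ \oo --> 0%E.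
  by under eq_fun do rewrite int0; exact: cvg_cst.
by move/(cvg_unique _ cv); apply.
Unshelve. all: by end_near. Qed.

Lemma eq_normal_trace_smooth (F1 F2 : V -> V) f1 f2 (C0 : R) :
  (forall i, smooth (fun x => F1 x ord0 i)) ->
  (forall i, smooth (fun x => F2 x ord0 i)) ->
  (forall x, f1 x = \sum_i pderive i (fun y => F1 y ord0 i) x) ->
  (forall x, f2 x = \sum_i pderive i (fun y => F2 y ord0 i) x) ->
  (forall x, norm2 x <= 1 -> `|dotV x (F1 x) - dotV x (F2 x)| <= C0 * (1 - norm2 x)) ->
  eq_normal_trace (eball 1) F1 f1 F2 f2.
Proof.
move=> C1 C2 f1E f2E FC phi G HG; have [L2phi L2G _] := HG.
have mB : measurable (eball 1 : set V) := measurable_eball ltr01.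
have it (F : V -> V) f : (forall i, smooth (fun x => F x ord0 i)) ->
    (forall x, f x = \sum_i pderive i (fun y => F y ord0 i) x) ->
    mu.-integrable (eball 1) (EFin \o (fun x => dotV (F x) (G x) + f x * phi x)).
  move=> CF fE.
  have i1 : mu.-integrable (eball 1) (EFin \o (fun x => dotV (F x) (G x))).
    have iFG i : mu.-integrable (eball 1) (EFin \o (fun x => F x ord0 i * G x ord0 i)).
      have := integrable_mul_continuous (smooth_continuous (CF i)) (L2_integrable (L2G i)).
      by apply: (eq_integrable mB) => x _ /=; rewrite mulrC.
    by have [] := Rintegral_sum mB (index_enum 'I_N) iFG.
  have i2 : mu.-integrable (eball 1)
      (EFin \o (fun x => phi x * \sum_i pderive i (fun y => F y ord0 i) x)).
    apply: integrable_mul_continuous; last exact: L2_integrable.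
    by apply: smooth_continuous; apply: smooth_sum => i; exact: smooth_pderive.
  have := integrableD mB i1 i2; apply: (eq_integrable mB) => x _ /=.
  by rewrite -EFinD fE [phi x * _]mulrC.
apply/eqP; rewrite -subr_eq0 /normal_trace -RintegralB//; last 2 first.
- exact: it.
- exact: it.
have CF i : smooth (fun x => F1 x ord0 i - F2 x ord0 i) by exact: smooth_sub.
have FC' x : norm2 x <= 1 ->
    `|\sum_i x ord0 i * (F1 x ord0 i - F2 x ord0 i)| <= C0 * (1 - norm2 x).
  move=> x1; apply: le_trans (FC x x1); rewrite /dotV -sumrB.
  by under eq_bigr do rewrite mulrBr.
rewrite -[X in _ == X](normal_trace_eq0 CF FC' HG).
apply/eqP; apply: eq_Rintegral => x _; rewrite /dotV f1E f2E.
under [in RHS]eq_bigr do rewrite mulrBl.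
under [X in _ = _ + X * _]eq_bigr do rewrite pderive_sub//.
by rewrite !sumrB; ring.
Qed.

End green.

(** * Harmonic polynomials times radial functions *)

Section harmonic.
Context {R : realType} {N : nat}.
Local Notation V := 'rV[R]_N.
Variables (i0 i1 : 'I_N) (i01 : i0 != i1).
Implicit Types (x : V) (i : 'I_N) (m : nat).

(** Real and imaginary parts of [(x_i0 + i x_i1)^m]. *)
Fixpoint reim m x : R * R :=
  if m is m'.+1 then
    let: (p, q) := reim m' x in
    (x ord0 i0 * p - x ord0 i1 * q, x ord0 i0 * q + x ord0 i1 * p)
  else (1, 0).

Definition re_pow m x := (reim m x).1.
Definition im_pow m x := (reim m x).2.

Lemma re_powS m x :
  re_pow m.+1 x = x ord0 i0 * re_pow m x - x ord0 i1 * im_pow m x.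
Proof. by rewrite /re_pow /im_pow /=; case: reim. Qed.

Lemma im_powS m x :
  im_pow m.+1 x = x ord0 i0 * im_pow m x + x ord0 i1 * re_pow m x.
Proof. by rewrite /re_pow /im_pow /=; case: reim. Qed.

Lemma smooth_reim m : smooth (re_pow m) /\ smooth (im_pow m).
Proof.
elim: m => [|m [Cp Cq]]; first by split; exact: smooth_cst.
have -> : re_pow m.+1 = (fun x => x ord0 i0 * re_pow m x + -1 * (x ord0 i1 * im_pow m x)).
  by apply/funext => x; rewrite re_powS mulN1r.
have -> : im_pow m.+1 = (fun x => x ord0 i0 * im_pow m x + x ord0 i1 * re_pow m x).
  by apply/funext => x; rewrite im_powS.
split; apply: smooth_add.
- exact: smooth_mul (smooth_coord _) Cp.
- exact: smooth_scale (smooth_mul (smooth_coord _) Cq).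
- exact: smooth_mul (smooth_coord _) Cq.
- exact: smooth_mul (smooth_coord _) Cp.
Qed.

(** The Cauchy-Riemann equations for [z^m]. *)
Lemma is_derive_reim m x i :
  is_derive x (unit_vec i) (re_pow m)
    (m%:R * ((i == i0)%:R * re_pow m.-1 x - (i == i1)%:R * im_pow m.-1 x)) /\
  is_derive x (unit_vec i) (im_pow m)
    (m%:R * ((i == i0)%:R * im_pow m.-1 x + (i == i1)%:R * re_pow m.-1 x)).
Proof.
elim: m => [|m [dp dq]].
  by rewrite !mul0r; split; exact: is_derive_cst.
have d0 := is_derive_coord x i i0; have d1 := is_derive_coord x i i1.
have Ep : re_pow m.+1 = (fun x => x ord0 i0 * re_pow m x + -1 * (x ord0 i1 * im_pow m x)).
  by apply/funext => y; rewrite re_powS mulN1r.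
have Eq : im_pow m.+1 = (fun x => x ord0 i0 * im_pow m x + x ord0 i1 * re_pow m x).
  by apply/funext => y; rewrite im_powS.
have Sp : m%:R * re_pow m x = m%:R * (x ord0 i0 * re_pow m.-1 x - x ord0 i1 * im_pow m.-1 x).
  by case: (m) => [|k]; rewrite ?mul0r// re_powS.
have Sq : m%:R * im_pow m x = m%:R * (x ord0 i0 * im_pow m.-1 x + x ord0 i1 * re_pow m.-1 x).
  by case: (m) => [|k]; rewrite ?mul0r// im_powS.
rewrite Ep Eq /= -natr1 !mulrDl !mul1r; split.
- apply: (is_derive_eq (is_derive_addf (is_derive_mulf d0 dp)
    (is_derive_scalef (-1) (is_derive_mulf d1 dq)))).
  transitivity ((i == i0)%:R * (m%:R * re_pow m x) - (i == i1)%:R * (m%:R * im_pow m x)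
    + ((i == i0)%:R * re_pow m x - (i == i1)%:R * im_pow m x)); last by ring.
  by rewrite Sp Sq; ring.
- apply: (is_derive_eq (is_derive_addf (is_derive_mulf d0 dq) (is_derive_mulf d1 dp))).
  transitivity ((i == i0)%:R * (m%:R * im_pow m x) + (i == i1)%:R * (m%:R * re_pow m x)
    + ((i == i0)%:R * im_pow m x + (i == i1)%:R * re_pow m x)); last by ring.
  by rewrite Sp Sq; ring.
Qed.

Lemma pderive_re_pow m i x : pderive i (re_pow m) x =
  m%:R * ((i == i0)%:R * re_pow m.-1 x - (i == i1)%:R * im_pow m.-1 x).
Proof. by apply: pderive_val; have [] := is_derive_reim m x i. Qed.

Lemma pderive_im_pow m i x : pderive i (im_pow m) x =
  m%:R * ((i == i0)%:R * im_pow m.-1 x + (i == i1)%:R * re_pow m.-1 x).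
Proof. by apply: pderive_val; have [] := is_derive_reim m x i. Qed.

Lemma sum_delta (F : 'I_N -> R) j : \sum_i (i == j)%:R * F i = F j.
Proof.
rewrite (bigD1 j)//= eqxx mul1r big1 ?addr0// => i /negbTE ->.
by rewrite mul0r.
Qed.

Lemma euler_re_pow m x : \sum_i x ord0 i * pderive i (re_pow m) x = m%:R * re_pow m x.
Proof.
transitivity (m%:R * (\sum_i (i == i0)%:R * (x ord0 i * re_pow m.-1 x) -
    \sum_i (i == i1)%:R * (x ord0 i * im_pow m.-1 x))).
  rewrite -sumrB mulr_sumr; apply: eq_bigr => i _; rewrite pderive_re_pow; ring.
rewrite !sum_delta; case: m => [|m]; first by rewrite !mul0r.
by rewrite re_powS.
Qed.

Lemma laplacian_re_pow m x : \sum_i pderive i (pderive i (re_pow m)) x = 0.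
Proof.
have [Cp Cq] := smooth_reim m.-1.
transitivity (m%:R * (\sum_i (i == i0)%:R * pderive i (re_pow m.-1) x -
    \sum_i (i == i1)%:R * pderive i (im_pow m.-1) x)).
  rewrite -sumrB mulr_sumr; apply: eq_bigr => i _.
  apply: pderive_val.
  have -> : pderive i (re_pow m) = (fun x =>
    m%:R * ((i == i0)%:R * re_pow m.-1 x + - (i == i1)%:R * im_pow m.-1 x)).
    by apply/funext => y; rewrite pderive_re_pow mulNr.
  have := is_derive_scalef m%:R (is_derive_addf
    (is_derive_scalef (i == i0)%:R (smooth_is_derive x i Cp))
    (is_derive_scalef (- (i == i1)%:R) (smooth_is_derive x i Cq))).
  by move/is_derive_eq; apply; rewrite mulNr.
rewrite !sum_delta pderive_re_pow pderive_im_pow !eqxx.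
by rewrite (negbTE i01) [i1 == i0]eq_sym (negbTE i01) !mul0r !mul1r add0r subr0 subrr mulr0.
Qed.

Variable W : nat -> R -> R.
Hypothesis dW : forall k (t : R), is_derive t 1 (W k) (W k.+1 t).

Definition re_pow_radial m x := re_pow m x * W 0 (norm2 x).

Lemma smooth_radial k : smooth (fun x => W k (norm2 x)).
Proof. by apply: smooth_comp => //; exact: smooth_norm2. Qed.

Lemma smooth_re_pow_radial m : smooth (re_pow_radial m).
Proof. by apply: smooth_mul; [have [] := smooth_reim m | exact: smooth_radial]. Qed.

Lemma pderive_radial k i x :
  pderive i (fun y => W k (norm2 y)) x = 2 * x ord0 i * W k.+1 (norm2 x).
Proof.
by rewrite (@pderive_comp _ _ _ (W k.+1))// ?pderive_norm2//; exact: smooth_norm2.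
Qed.

Lemma pderive_re_pow_radial m i x : pderive i (re_pow_radial m) x =
  re_pow m x * (2 * x ord0 i * W 1 (norm2 x)) +
  W 0 (norm2 x) * pderive i (re_pow m) x.
Proof.
have [Cp _] := smooth_reim m.
by rewrite pderive_mul// ?pderive_radial//; exact: smooth_radial.
Qed.

Lemma euler_re_pow_radial m x :
  \sum_i x ord0 i * pderive i (re_pow_radial m) x =
  re_pow m x * (m%:R * W 0 (norm2 x) + 2 * norm2 x * W 1 (norm2 x)).
Proof.
transitivity (2 * re_pow m x * W 1 (norm2 x) * (\sum_i x ord0 i ^+ 2) +
    W 0 (norm2 x) * \sum_i x ord0 i * pderive i (re_pow m) x).
  rewrite !mulr_sumr -big_split /=; apply: eq_bigr => i _.
  by rewrite pderive_re_pow_radial; ring.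
by rewrite euler_re_pow -/(norm2 x); ring.
Qed.

Lemma laplacian_re_pow_radial m x :
  \sum_i pderive i (pderive i (re_pow_radial m)) x =
  re_pow m x * (4 * norm2 x * W 2 (norm2 x) + (4 * m%:R + 2 * N%:R) * W 1 (norm2 x)).
Proof.
have [Cp _] := smooth_reim m.
have dR k i := is_derive_compf (dW k (norm2 x)) (smooth_is_derive x i (@smooth_norm2 R N)).
have E i : pderive i (pderive i (re_pow_radial m)) x =
    4 * W 1 (norm2 x) * (x ord0 i * pderive i (re_pow m) x)
    + 4 * re_pow m x * W 2 (norm2 x) * x ord0 i ^+ 2 + 2 * re_pow m x * W 1 (norm2 x)
    + W 0 (norm2 x) * pderive i (pderive i (re_pow m)) x.
  apply: pderive_val.
  rewrite (_ : pderive i (re_pow_radial m) = (fun x => re_pow m x *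
    (2 * (x ord0 i * W 1 (norm2 x))) + W 0 (norm2 x) * pderive i (re_pow m) x)).
    have := is_derive_addf (is_derive_mulf (smooth_is_derive x i Cp)
      (is_derive_scalef 2 (is_derive_mulf (is_derive_coord x i i) (dR 1%N i))))
      (is_derive_mulf (dR 0%N i) (smooth_is_derive x i (smooth_pderive i Cp))).
    by move/is_derive_eq; apply; rewrite eqxx pderive_norm2 /=; ring.
  by apply/funext => y; rewrite pderive_re_pow_radial; ring.
under eq_bigr do rewrite E.
rewrite !big_split /= -!mulr_sumr euler_re_pow laplacian_re_pow -/(norm2 x).
by rewrite sumr_const card_ord -mulr_natr; ring.
Qed.

End harmonic.

Section bessel_profile.
Context {R : realType}.
Variables (N M : nat) (N1 : (1 < N)%N) (alpha K : R).

Let a : R := order_of N M.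
Let a1 : 1 <= a. Proof. exact: order_of_ge1. Qed.

(** Each derivative in [s = |x|^2] contributes [K^2] and the factor by which
    differentiation multiplies [bessel] when it shifts the parameter. *)
Fixpoint profile_coef (k : nat) : R :=
  if k is k'.+1 then profile_coef k' * (K ^+ 2 * - (4 * (a + k'%:R))^-1)
  else alpha.

Definition profile (k : nat) (s : R) : R :=
  profile_coef k * bessel (a + k%:R) (K ^+ 2 * s).

Lemma is_derive_profile k (s : R) : is_derive s 1 (profile k) (profile k.+1 s).
Proof.
have ak : 1 <= a + k%:R by rewrite (le_trans a1)// lerDl.
have := is_derive_scalef (profile_coef k) (@is_derive_compf _ _ (bessel (a + k%:R))
  (fun s => K ^+ 2 * s) s 1 _ _ (is_derive_bessel _ ak)
  (is_derive_scalef (K ^+ 2) (is_derive_id s 1))).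
have kE : a + k%:R + 1 = a + k.+1%:R by rewrite -(natr1 k) addrA.
by rewrite kE => /is_derive_eq; apply; rewrite /profile [profile_coef k.+1]/=; ring.
Qed.

Lemma profile_ode (s : R) :
  4 * s * profile 2 s + (4 * M%:R + 2 * N%:R) * profile 1 s = - K ^+ 2 * profile 0 s.
Proof.
rewrite /profile /= !addr0.
have -> : bessel a (K ^+ 2 * s) = bessel (a + 1) (K ^+ 2 * s) +
    - (4 * a * (a + 1))^-1 * (K ^+ 2 * s * bessel (a + 2) (K ^+ 2 * s)).
  by rewrite -bessel_contiguous//; ring.
have -> : 4 * M%:R + 2 * N%:R = 4 * a by rewrite /a /order_of; field.
by move: (a) a1 => b b1; field; rewrite !gt_eqF//; lra.
Qed.

Lemma profile0E (r : R) : profile 0 (r ^+ 2) = alpha * bw a (K * r).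
Proof. by rewrite /profile /= addr0 /bw exprMn. Qed.

Lemma profile_euler (r : R) :
  M%:R * profile 0 (r ^+ 2) + 2 * r ^+ 2 * profile 1 (r ^+ 2) = alpha * bE N M (K * r).
Proof.
rewrite profile0E /profile /bE /= -/a /bw1 !addr0 exprMn.
by move: (a) a1 => b b1; field; rewrite gt_eqF//; lra.
Qed.

End bessel_profile.

(** * Traces, norms and concentration *)

Section trace.
Context {R : realType} {N : nat}.
Local Notation V := 'rV[R]_N.
Local Notation mu := (@lebesgue_rV R N).
Implicit Types (f g u : V -> R) (x : V) (i j : 'I_N).

Lemma norm2_scale (c : R) x : norm2 (c *: x) = c ^+ 2 * norm2 x.
Proof. by rewrite /norm2 mulr_sumr; apply: eq_bigr => i _; rewrite mxE exprMn. Qed.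

Lemma norm2_radial x : x != 0 -> norm2 ((enorm x)^-1 *: x) = 1.
Proof.
move=> x0; rewrite norm2_scale -enorm_sqr -exprMn mulVf ?expr1n//.
apply: contra_neq x0 => x0; apply/rowP => i; rewrite mxE.
apply/eqP; rewrite -[_ == 0](@sqrf_eq0 R) eq_le sqr_ge0 andbT.
by rewrite (le_trans (coord_sqr_le i x))// -enorm_sqr x0 expr0n.
Qed.

Lemma measurable_radial g : continuous g -> measurable_fun setT (radial g).
Proof.
move=> cg; apply: (@measurableT_comp _ _ _ _ _ _ g).
  exact: continuous_measurable_rV.
apply: measurable_fun_rV => i; under eq_fun do rewrite mxE.
apply: measurable_funM; last exact: measurable_coord.
under eq_fun do rewrite -powR_inv1 ?sqrtr_ge0//.
apply: (@measurableT_comp _ _ _ _ _ _ (fun t : R => t `^ (-1))).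
  exact: measurable_powR.
apply: continuous_measurable_rV => //.
apply: (@continuous_compf _ _ Num.sqrt (@norm2 R N)).
  exact: sqrt_continuous.
exact/smooth_continuous/smooth_norm2.
Qed.

Lemma L2sphere_continuous g : continuous g -> L2sphere g.
Proof.
move=> cg; have mB : measurable (eball 1 : set V) := measurable_eball ltr01.
have mr : measurable_fun (eball 1) (radial g).
  exact: measurable_funS (measurable_radial cg).
have [C C0 gC] := cball_bounded cg.
have rC x : `|radial g x| <= C.
  have [->|x0] := eqVneq x 0.
    by apply: gC; rewrite scaler0 /norm2 big1 ?ler01// => i _; rewrite mxE expr0n.
  by apply: gC; rewrite norm2_radial.
apply: L2_of_integrable => //; apply: measurable_bounded_integrable => //.
- exact: eball_lty.
- exact: measurable_funX.
exists (C ^+ 2); split; first exact: num_real.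
move=> y Cy x _ /=; rewrite normrX (le_trans _ (ltW Cy))//.
by rewrite lerXn2r// nnegrE.
Qed.

Lemma L2norm_cst0 (U : set V) : L2norm U (fun=> 0) = 0%E.
Proof.
rewrite /L2norm (_ : EFin \o _ = cst 0%E) ?Lnorm0//.
by apply/funext => x; rewrite /= /patch; case: ifP.
Qed.

(** The smooth function is its own approximation, and the trace only matters on the
    sphere, except that [radial] fixes the origin. *)
Lemma sphere_trace_smooth u g : smooth u -> smooth g -> u 0 = g 0 ->
  (forall x, norm2 x = 1 -> u x = g x) -> sphere_trace u (grad u) g.
Proof.
move=> Cu Cg ug0 ug; split; first exact/L2sphere_continuous/smooth_continuous.
have cvg0 (U : set V) (f : V -> R) (l : nat -> \bar R) : (forall x, f x = 0) ->
    (l = fun=> L2norm U f) -> l m @[m --> \oo] --> 0%E.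
  move=> f0 ->; have -> : f = fun=> 0 by apply/funext.
  by rewrite L2norm_cst0; exact: cvg_cst.
exists (fun=> u); split => //.
- by apply: (@cvg0 (eball 1) (u \- u)) => // x; rewrite /= subrr.
- move=> i; apply: (@cvg0 (eball 1) (fun x => grad u x ord0 i - pderive i u x)) => // x.
  by rewrite mxE subrr.
have -> : L2sphere_norm (g \- u) = 0%E; last exact: cvg_cst.
rewrite /L2sphere_norm.
have -> : radial (g \- u) = fun=> 0.
  apply/funext => x; rewrite /radial /=; have [->|x0] := eqVneq x 0.
    by rewrite scaler0 ug0 subrr.
  by rewrite ug ?subrr// norm2_radial.
by rewrite L2norm_cst0 mule0.
Qed.

Lemma continuous_not_ae0 u x : continuous u -> eball 1 x -> u x != 0 ->
  ~ (u = cst 0 %[ae mu in eball 1]).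
Proof.
move=> cu xB ux0 ae0.
have oU : open (eball 1 `&` [set y | u y != 0]).
  apply: openI; first exact: open_eball.
  by move/continuousP : cu => /(_ [set t | t != 0]); apply; exact: open_neq.
have : nbhs x (eball 1 `&` [set y | u y != 0]) by apply: open_nbhs_nbhs.
move=> /nbhs_ballP[e /= e0 eU].
have : mu (box x e) = 0%E.
  apply: measure_negligible; first exact: measurable_box.
  apply: negligibleS ae0 => y xy /= /(_ _)H.
  have [yB uy] : (eball 1 `&` [set y | u y != 0]) y.
    by apply: eU; split => // i j; rewrite !ord1 /ball /= distrC; exact: xy.
  by move: uy; rewrite /= H ?eqxx.
rewrite lebesgue_rV_box// => -[] /eqP; rewrite expf_eq0 => /andP[_].
by rewrite gt_eqF// mulr_gt0.
Qed.

Lemma L2norm_continuous u r : continuous u -> 0 < r -> r <= 1 ->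
  L2norm (eball r) u = (Num.sqrt (\int[mu]_(x in eball r) u x ^+ 2))%:E.
Proof.
move=> cu r0 r1; apply: L2norm_sqrt; first exact: measurable_eball.
apply: (@integrableS _ _ _ _ (eball 1)).
- exact: measurable_eball.
- exact: measurable_eball.
- by move=> x; rewrite /eball /= => /lt_le_trans; apply.
- by apply: integrable_eball; exact: continuous_mulf.
Qed.

Lemma Rintegral_sqr_gt0 u x : continuous u -> eball 1 x -> u x != 0 ->
  0 < \int[mu]_(x in eball 1) u x ^+ 2.
Proof.
move=> cu xB ux; rewrite lt_neqAle Rintegral_ge0 ?andbT; last first.
  by move=> y _; exact: sqr_ge0.
apply/eqP => E.
have N0 : L2norm (eball 1) u = 0%E.
  by rewrite L2norm_continuous// -E sqrtr0.
apply: (continuous_not_ae0 cu xB ux).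
have mB : measurable (eball 1 : set V) := measurable_eball ltr01.
have mu_ : measurable_fun setT (EFin \o u \_ (eball 1)).
  apply/measurable_EFinP; apply: (measurable_restrictT _ mB).1.
  exact: continuous_measurable_rV.
have p0 : (0 < 2%:E :> \bar R)%E by rewrite lte_fin.
have := Lnorm_eq0_eq0 mu_ p0 N0.
apply: filterS => y /= /(_ I) + yB; rewrite patchE mem_set// => -[].
exact.
Qed.

(** Integrating [div (x u^2 chi)] over the ball for a radial cut-off [chi]: a field
    that grows fast in the radial direction has little mass inside. *)
Lemma radial_growth_concentration (tau rho : R) : 0 < tau -> tau < rho -> rho < 1 ->
  exists2 C : R, 0 <= C & forall u (d : R), 0 < d -> smooth u ->
  (forall x, norm2 x <= rho ^+ 2 ->
     d * u x ^+ 2 <= u x * \sum_i x ord0 i * pderive i u x) ->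
  \int[mu]_(x in eball tau) u x ^+ 2 <=
    C / d * \int[mu]_(x in eball 1) u x ^+ 2.
Proof.
move=> tau0 taur rho1; have rho0 : 0 < rho by exact: lt_trans taur.
have [C1 C10 eC1] := flat_bounded ('X^2 : {poly R}).
pose e0 : R := flat 1 (rho ^+ 2 - tau ^+ 2).
have s0 : 0 < rho ^+ 2 - tau ^+ 2 by rewrite subr_gt0 ltrXn2r// ?nnegrE ltW.
have e00 : 0 < e0 by rewrite /e0 /flat s0 hornerC mul1r expR_gt0.
exists (C1 / e0); first by rewrite divr_ge0// ltW.
move=> u d d0 Cu grow; have mB : measurable (eball 1 : set V) := measurable_eball ltr01.
pose inner x : R := rho ^+ 2 - norm2 x.
have Ci : smooth inner by apply: smooth_sub; [exact: smooth_cst|exact: smooth_norm2].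
pose chi x := flat 1 (inner x).
have Cchi : smooth chi := smooth_flat 1 Ci.
have chi0 x : rho ^+ 2 <= norm2 x -> chi x = 0.
  by move=> rx; apply: flat_le0; rewrite subr_le0.
have chi_ge0 x : 0 <= chi x.
  rewrite /chi /flat; case: ifP => // _.
  by rewrite hornerC mul1r expR_ge0.
have chie0 x : norm2 x < tau ^+ 2 -> e0 <= chi x.
  move=> xt; have sx : 0 < inner x by rewrite /inner; lra.
  rewrite /e0 /chi /flat s0 sx !hornerC !mul1r ler_expR lerN2 lef_pV2//.
  by rewrite /inner; lra.
have dchi i x : pderive i chi x = - 2 * x ord0 i * flat 'X^2 (inner x).
  have := @pderive_comp R N (flat 1) (flat (dflat 1)) inner i x (is_derive_flat 1) Ci.
  rewrite dflat1 => ->; congr (_ * _).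
  rewrite pderive_sub; [|exact: smooth_cst|exact: smooth_norm2].
  by rewrite pderive_norm2 (pderive_val (is_derive_cst _ _ _)); ring.
pose psi i x := x ord0 i * (u x ^+ 2 * chi x).
have Cu2 : smooth (fun x => u x ^+ 2) by apply: smooth_mul.
have Cpsi i : smooth (psi i).
  by apply: smooth_mul; [exact: smooth_coord|exact: smooth_mul].
have int0 i : \int[mu]_(x in eball 1) pderive i (psi i) x = 0.
  apply: (@Rintegral_pderive_eq0 R N (psi i) i [set x | norm2 x <= rho ^+ 2]).
  - exact: Cpsi.
  - by apply: compact_norm2_le; rewrite expr_le1 ?ltW.
  - by move=> x /= xr; rewrite eballE//= expr1n (le_lt_trans xr)// expr_lt1// ltW.
  - move=> x /negP; rewrite -ltNge => xr.
    by rewrite /psi chi0 ?mulr0// ltW.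
have dpsi x : \sum_i pderive i (psi i) x = N%:R * (u x ^+ 2 * chi x) +
    2 * chi x * (u x * \sum_i x ord0 i * pderive i u x)
    - 2 * flat 'X^2 (inner x) * norm2 x * u x ^+ 2.
  transitivity (\sum_i (u x ^+ 2 * chi x + 2 * chi x * u x * (x ord0 i * pderive i u x)
      - 2 * flat 'X^2 (inner x) * u x ^+ 2 * x ord0 i ^+ 2)).
    apply: eq_bigr => i _; rewrite pderive_mul; [|exact: smooth_coord|exact: smooth_mul].
    rewrite pderive_mul// pderive_mul// dchi (pderive_val (is_derive_coord x i i)) eqxx /=.
    by ring.
  rewrite sumrB big_split /= -!mulr_sumr -/(norm2 x) sumr_const card_ord -mulr_natl.
  by ring.
have ic f : smooth f -> mu.-integrable (eball 1) (EFin \o f).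
  by move=> Cf; apply: integrable_eball; exact: smooth_continuous.
have [_ E] := Rintegral_sum mB (index_enum 'I_N)
  (fun i => ic _ (smooth_pderive i (Cpsi i))).
have S0 : \int[mu]_(x in eball 1) (\sum_i pderive i (psi i) x) = 0.
  by rewrite E big1.
have Cc : smooth (fun x => u x ^+ 2 * chi x) by exact: smooth_mul.
have ineq : \int[mu]_(x in eball 1) (2 * d * (u x ^+ 2 * chi x)) <=
    \int[mu]_(x in eball 1) (2 * C1 * u x ^+ 2).
  rewrite -subr_le0 -RintegralB//; last 2 first.
  - by apply: ic; exact: smooth_scale.
  - by apply: ic; exact: smooth_scale.
  rewrite -S0; apply: le_Rintegral => //.
  - by apply: ic; apply: smooth_sub; exact: smooth_scale.
  - by apply: ic; apply: smooth_sum => i; exact: smooth_pderive.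
  move=> x xB; have x1 := eball_norm2_le xB; rewrite dpsi.
  have t1 : 0 <= N%:R * (u x ^+ 2 * chi x) by rewrite mulr_ge0// mulr_ge0 ?sqr_ge0.
  have t2 : 2 * d * (u x ^+ 2 * chi x) <=
      2 * chi x * (u x * \sum_i x ord0 i * pderive i u x).
    have [xr|xr] := leP (norm2 x) (rho ^+ 2); last first.
      by rewrite (chi0 _ (ltW xr)) !(mulr0, mul0r).
    have := ler_wpM2l (chi_ge0 x) (grow x xr); lra.
  have t3 : 2 * flat 'X^2 (inner x) * norm2 x * u x ^+ 2 <= 2 * C1 * u x ^+ 2.
    rewrite ler_wpM2r ?sqr_ge0// -mulrA ler_pM2l//.
    rewrite (le_trans (ler_norm _))// normrM -[leRHS]mulr1 ler_pM//.
    by rewrite ger0_norm// norm2_ge0.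
  lra.
rewrite !RintegralZl in ineq => //; [|exact: ic|exact: ic].
have low : e0 * \int[mu]_(x in eball tau) u x ^+ 2 <=
    \int[mu]_(x in eball 1) (u x ^+ 2 * chi x).
  have tauE : eball tau = eball 1 `&` (eball tau : set V).
    rewrite setIC; apply/esym/setIidl => x; rewrite /eball /=.
    by move=> /lt_le_trans; apply; rewrite ltW// (lt_trans taur).
  have mt : measurable (eball tau : set V) by exact: measurable_eball.
  have it : mu.-integrable (eball tau) (EFin \o (fun x => u x ^+ 2)).
    by apply: (integrableS mB mt _ (ic _ Cu2)); rewrite tauE; exact: subIsetl.
  rewrite -RintegralZl// tauE Rintegral_mkcondr; apply: le_Rintegral => //.
  - have h : mu.-integrable (eball tau) (EFin \o (fun x => e0 * u x ^+ 2)).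
      by have := integrableZl mt e0 it; apply: (eq_integrable mt).
    have /(integrableS measurableT mB (@subsetT _ _)) := (integrable_mkcond _ mt).1 h.
    by apply: (eq_integrable mB) => x _; rewrite /= !patchE; case: ifP.
  - exact: ic.
  move=> x xB; rewrite patchE; case: ifPn => [|_]; last first.
    by rewrite mulr_ge0 ?sqr_ge0.
  rewrite inE eballE//= => xt; rewrite mulrC ler_wpM2l ?sqr_ge0// chie0//.
rewrite mulrAC ler_pdivlMr// [C1 / e0 * _]mulrAC ler_pdivlMr//.
by have := ler_wpM2l (ltW d0) low; lra.
Qed.

End trace.

(** * Transmission eigenpairs of the ball *)

Section eigenpair.
Context {R : realType} {N : nat}.
Variables (N1 : (1 < N)%N) (i0 i1 : 'I_N) (i01 : i0 != i1).
Local Notation V := 'rV[R]_N.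
Local Notation mu := (@lebesgue_rV R N).
Implicit Types (x : V) (i : 'I_N).

(** Up to a constant factor, [|x|^(1 - N/2) J(K |x|)] times a spherical harmonic of
    degree [M], with [J] the Bessel function of order [M + N/2 - 1]. *)
Definition mode (M : nat) (alpha K : R) : V -> R :=
  re_pow_radial i0 i1 (profile N M alpha K) M.

Lemma smooth_mode M alpha K : smooth (mode M alpha K).
Proof. exact: (smooth_re_pow_radial i0 i1 (is_derive_profile M N1 alpha K)). Qed.

Lemma laplacian_mode M alpha K x :
  \sum_i pderive i (pderive i (mode M alpha K)) x = - K ^+ 2 * mode M alpha K x.
Proof.
rewrite (laplacian_re_pow_radial i01 (is_derive_profile M N1 alpha K)).
by rewrite (profile_ode M N1) /mode /re_pow_radial; ring.
Qed.

Lemma mode0 M alpha K : (0 < M)%N -> mode M alpha K 0 = 0.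
Proof.
case: M => // M _; rewrite /mode /re_pow_radial re_powS !mxE.
by rewrite !mul0r subr0 mul0r.
Qed.

Lemma mode_sphere M alpha K x : norm2 x = 1 ->
  mode M alpha K x = re_pow i0 i1 M x * (alpha * bw (order_of N M) K).
Proof.
move=> x1; rewrite /mode /re_pow_radial x1.
by have := profile0E N M alpha K 1; rewrite expr1n mulr1 => ->.
Qed.

Lemma euler_mode M alpha K x :
  \sum_i x ord0 i * pderive i (mode M alpha K) x =
  re_pow i0 i1 M x * (alpha * bE N M (K * enorm x)).
Proof.
rewrite (euler_re_pow_radial i0 i1 (is_derive_profile M N1 alpha K)).
by rewrite -(profile_euler M N1) enorm_sqr.
Qed.

Lemma modeE M alpha K x :
  mode M alpha K x = re_pow i0 i1 M x * (alpha * bw (order_of N M) (K * enorm x)).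
Proof. by rewrite -profile0E enorm_sqr. Qed.

Lemma mode_growth (b d : nat) alpha K rho : (0 < b)%N -> 0 <= K -> 0 <= rho ->
  (K * rho) ^+ 2 <= b%:R * (b + 2 * d)%:R ->
  forall x, norm2 x <= rho ^+ 2 ->
  let u := mode (b + d) alpha K in
  d%:R * u x ^+ 2 <= u x * \sum_i x ord0 i * pderive i u x.
Proof.
move=> b0 K0 rho0 Kb x xr /=; rewrite euler_mode modeE.
have xr' : 0 <= K * enorm x <= K * rho.
  rewrite mulr_ge0 ?sqrtr_ge0//= ler_wpM2l//.
  by rewrite -(@ler_pXn2r _ 2)// ?nnegrE ?sqrtr_ge0// enorm_sqr.
have [w0 wE] := bw_growth N1 b0 (mulr_ge0 K0 rho0) Kb xr'.
set P := re_pow _ _ _ x; set w := bw _ _ in w0 wE *; set E := bE _ _ _ in wE *.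
have -> : d%:R * (P * (alpha * w)) ^+ 2 = (P * alpha) ^+ 2 * (w * (d%:R * w)) by ring.
have -> : P * (alpha * w) * (P * (alpha * E)) = (P * alpha) ^+ 2 * (w * E) by ring.
by rewrite ler_wpM2l ?sqr_ge0// ler_pM2l.
Qed.

Lemma re_pow_axis m (c : R) : re_pow i0 i1 m (c *: unit_vec i0) = c ^+ m /\
  im_pow i0 i1 m (c *: unit_vec i0) = 0.
Proof.
elim: m => [|m [p q]]; first by [].
rewrite re_powS im_powS p q !mxE !eqxx [i1 == i0]eq_sym (negbTE i01) /=.
by rewrite exprS; split; ring.
Qed.

Lemma norm2_axis (c : R) : norm2 (c *: unit_vec i0 : V) = c ^+ 2.
Proof.
rewrite norm2_scale /norm2 (bigD1 i0)//= big1 => [|i ii0].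
  by rewrite mxE !eqxx /= expr1n addr0 mulr1.
by rewrite mxE (negbTE ii0) andbF expr0n.
Qed.

Lemma mode_axis_neq0 M alpha K c : 0 < c -> alpha != 0 ->
  0 < bw (order_of N M) (K * c) -> mode M alpha K (c *: unit_vec i0) != 0.
Proof.
move=> c0 a0 w0; rewrite modeE (re_pow_axis M c).1.
have -> : enorm (c *: unit_vec i0 : V) = c.
  by rewrite /enorm -/(norm2 _) norm2_axis sqrtr_sqr gtr0_norm.
by rewrite !mulf_neq0 ?expf_neq0// gt_eqF.
Qed.

(** The normal component of a difference of two modes is the product of a bounded
    function and of such an [H (|x|^2)]. *)
Lemma radial_lipschitz (H dH : R -> R) : (forall s : R, is_derive s 1 H (dH s)) ->
  continuous dH -> H 1 = 0 ->
  exists2 C : R, 0 <= C & forall s, 0 <= s <= 1 -> `|H s| <= C * (1 - s).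
Proof.
move=> dHH cdH H1.
have : compact (dH @` `[0, 1]).
  by apply: continuous_compact; [exact: continuous_subspaceT|exact: segment_compact].
move=> /compact_bounded[A [_ AH]]; exists (`|A| + 1); first by rewrite addr_ge0.
move=> s /andP[s0 s1].
have cH : {within `[s, 1], continuous H}.
  exact/continuous_subspaceT/(continuous_derivable dHH).
have [c cs] := MVT_segment s1 (fun y _ => dHH y) cH.
rewrite H1 sub0r => E; rewrite -normrN E normrM.
rewrite [`|1 - s|]ger0_norm ?subr_ge0// ler_wpM2r ?subr_ge0//.
apply: (AH (`|A| + 1)); first by rewrite (le_lt_trans (ler_norm _))// ltrDl.
by exists c => //=; move: cs; rewrite !in_itv /= => /andP[sc ->]; rewrite (le_trans s0).
Qed.

(** The coefficients are exchanged so that the values agree on the sphere; the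
    hypothesis relating [bE] and [bw] is then the equality of the normal
    derivatives. *)
Lemma transmission_eigenpair_modes (sigma n kappa K : R) M :
  0 < kappa -> sigma * kappa ^+ 2 = n ^+ 2 -> (0 < M)%N -> 0 < K ->
  let a := order_of N M in let k := K / kappa in
  sigma * bE N M K * bw a k = bw a K * bE N M k ->
  ~ (mode M (bw a k) K = cst 0 %[ae mu in eball 1]) ->
  transmission_eigenpair sigma n k (mode M (bw a k) K) (mode M (bw a K) k).
Proof.
move=> kap0 nE M0 K0 a k De nontriv.
set u := mode M (bw a k) K; set v := mode M (bw a K) k.
have Cu : smooth u by exact: smooth_mode.
have Cv : smooth v by exact: smooth_mode.
have KE : K = k * kappa by rewrite /k divfK// gt_eqF.
have Csu i : smooth (fun x => (sigma *: grad u x) ord0 i).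
  by under eq_fun do rewrite !mxE; exact/smooth_scale/smooth_pderive.
have Csv i : smooth (fun x => grad v x ord0 i).
  by under eq_fun do rewrite !mxE; exact/smooth_pderive.
have divu x : - (k ^+ 2 * n ^+ 2 * u x) =
    \sum_i pderive i (fun y => (sigma *: grad u y) ord0 i) x.
  transitivity (sigma * \sum_i pderive i (pderive i u) x).
    by rewrite laplacian_mode -/u KE -nE; ring.
  rewrite mulr_sumr; apply: eq_bigr => i _; rewrite -pderive_scale; last exact: smooth_pderive.
  by congr pderive; apply/funext => y; rewrite !mxE.
have divv x : - (k ^+ 2 * v x) = \sum_i pderive i (fun y => grad v y ord0 i) x.
  transitivity (\sum_i pderive i (pderive i v) x).
    by rewrite laplacian_mode -/v; ring.
  by apply: eq_bigr => i _; congr pderive; apply/funext => y; rewrite !mxE.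
split; first by rewrite divr_gt0.
split; first by case.
exists (grad u), (grad v); split.
- by split; exact: smooth_H1.
- exact: smooth_weak_div.
- exact: smooth_weak_div.
- exists u; split; apply: sphere_trace_smooth => //.
    by rewrite /u /v !mode0.
  by move=> x x1; rewrite /u /v !mode_sphere// -/a; ring.
pose pu := profile N M (bw a k) K; pose pv := profile N M (bw a K) k.
have dpu j (s : R) : is_derive s 1 (pu j) (pu j.+1 s) by exact: is_derive_profile.
have dpv j (s : R) : is_derive s 1 (pv j) (pv j.+1 s) by exact: is_derive_profile.
pose H s := sigma * (M%:R * pu 0 s + 2 * s * pu 1 s) +
  -1 * (M%:R * pv 0 s + 2 * s * pv 1 s).
pose dH1 (p : nat -> R -> R) s := M%:R * p 1 s + 2 * (p 1 s + s * p 2 s).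
pose dH s := sigma * dH1 pu s + -1 * dH1 pv s.
have dHH (s : R) : is_derive s 1 H (dH s).
  have d1 (p : nat -> R -> R) : (forall j (s : R), is_derive s 1 (p j) (p j.+1 s)) ->
      is_derive s 1 (fun s => M%:R * p 0 s + 2 * s * p 1 s) (dH1 p s).
    move=> dp; have := is_derive_addf (is_derive_scalef M%:R (dp 0%N s))
      (is_derive_mulf (is_derive_scalef 2 (is_derive_id s (1 : R))) (dp 1%N s)).
    by move/is_derive_eq; apply; rewrite /dH1; ring.
  exact: (is_derive_addf (is_derive_scalef sigma (d1 _ dpu))
    (is_derive_scalef (-1) (d1 _ dpv))).
have cdH : continuous dH.
  have c1 (p : nat -> R -> R) : (forall j (s : R), is_derive s 1 (p j) (p j.+1 s)) ->
      continuous (dH1 p).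
    move=> dp; have cp j := continuous_derivable (dp j).
    have cid : continuous (fun s : R => s) by move=> s; exact: cvg_id.
    by apply: continuous_addf; apply: continuous_mulf => //;
      [exact: cst_continuous|exact: cst_continuous|apply: continuous_addf => //; exact: continuous_mulf].
  by apply: continuous_addf; apply: continuous_mulf; by [exact: cst_continuous|exact: c1].
have H10 : H 1 = 0.
  have eu := profile_euler M N1 (bw a k) K 1; have ev := profile_euler M N1 (bw a K) k 1.
  rewrite !expr1n !mulr1 in eu ev.
  by rewrite /H !mulr1 eu ev -De; ring.
have [C C0 HC] := radial_lipschitz dHH cdH H10.
have [Cp _] := @smooth_reim R N i0 i1 M.
have [B B0 PB] := cball_bounded (smooth_continuous Cp).
suff HF x : norm2 x <= 1 ->
    `|dotV x (sigma *: grad u x) - dotV x (grad v x)| <= B * C * (1 - norm2 x).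
  exact: (eq_normal_trace_smooth Csu Csv divu divv HF).
move=> x1.
have eu := euler_re_pow_radial i0 i1 (is_derive_profile M N1 (bw a k) K) M x.
have ev := euler_re_pow_radial i0 i1 (is_derive_profile M N1 (bw a K) k) M x.
have -> : dotV x (sigma *: grad u x) - dotV x (grad v x) = re_pow i0 i1 M x * H (norm2 x).
  transitivity (sigma * (\sum_i x ord0 i * pderive i u x) - \sum_i x ord0 i * pderive i v x).
    rewrite mulr_sumr /dotV; congr (_ - _); apply: eq_bigr => i _; rewrite !mxE//; ring.
  by rewrite eu ev /H /pu /pv; ring.
rewrite normrM -mulrA ler_pM// ?PB// HC// norm2_ge0//.
Qed.

End eigenpair.

Section limits.
Context {R : realType} {N : nat}.
Local Notation V := 'rV[R]_N.
Local Notation mu := (@lebesgue_rV R N).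

Lemma ratio_cvg0 (u : nat -> V -> R) (tau C : R) : 0 < tau -> tau < 1 ->
  (forall m, smooth (u m)) ->
  (forall m, 0 < \int[mu]_(x in eball 1) u m x ^+ 2) ->
  (forall m, \int[mu]_(x in eball tau) u m x ^+ 2 <=
     C / m.+1%:R * \int[mu]_(x in eball 1) u m x ^+ 2) ->
  fine (L2norm (eball tau) (u m)) / fine (L2norm (eball 1) (u m)) @[m --> \oo] --> (0 : R).
Proof.
move=> tau0 tau1 Cu u0 uC.
apply: (@squeeze_cvgr _ _ _ _ (fun=> 0) (fun m => Num.sqrt (C * m.+1%:R^-1))).
- apply: nearW => m; have cu := smooth_continuous (Cu m).
  rewrite (L2norm_continuous cu tau0 (ltW tau1)) (L2norm_continuous cu ltr01 (lexx 1)).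
  rewrite /= divr_ge0 ?sqrtr_ge0//=.
  rewrite ler_pdivrMr ?sqrtr_gt0// -sqrtrM; last first.
    rewrite -(pmulr_lge0 _ (u0 m)) (le_trans _ (uC m))//.
    by apply: Rintegral_ge0 => x _; exact: sqr_ge0.
  by rewrite ler_wsqrtr.
- exact: cvg_cst.
have h : C * m.+1%:R^-1 @[m --> \oo] --> C * 0.
  by apply: cvgMl_tmp; exact: cvg_harmonic.
have := cvg_comp _ _ h (@sqrt_continuous R (C * 0)).
by rewrite mulr0 sqrtr0; exact.
Qed.

End limits.

(** * Localisation near the sphere *)

Section choice_of_parameters.
Context {R : realType}.

(** With [M = q d] and [K <= lam M], the last inequality says that
    [(K rho)^2 <= M^2 - d^2], as required for a growth of order [d] on the ball of
    radius [rho]; it holds for large [q] because [lam rho < 1]. *)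
Lemma exists_parameters (kappa tau : R) : 1 < kappa -> 0 < tau -> tau < 1 ->
  exists lam rho (q : nat), [/\ 1 < lam, lam <= kappa, tau < rho /\ rho < 1,
    (1 < q)%N & (lam * rho) ^+ 2 * q%:R ^+ 2 <= q%:R ^+ 2 - 1].
Proof.
move=> k1 t0 t1.
pose lam := Num.min kappa ((1 + tau^-1) / 2).
have ti : 1 < tau^-1 by rewrite invf_gt1.
have l1 : 1 < lam by rewrite /lam lt_min k1 /=; lra.
have lk : lam <= kappa by rewrite /lam ge_min lexx.
have lt : lam < tau^-1.
  by rewrite /lam gt_min; apply/orP; right; lra.
have l0 : 0 < lam by lra.
(* [rho] lies between [tau] and [1 / lam]. *)
pose rho := (tau + lam^-1) / 2.
have tl : tau < lam^-1 by rewrite -[tau]invrK ltf_pV2 ?posrE ?invr_gt0.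
have li : lam^-1 < 1 by rewrite invf_lt1.
have lr : lam * rho < 1.
  have -> : lam * rho = (lam * tau + 1) / 2.
    by rewrite /rho; field; rewrite gt_eqF.
  have : lam * tau < 1 by rewrite mulrC -ltr_pdivlMr// mul1r.
  by move=> ?; lra.
have rho0 : 0 < rho by rewrite /rho; lra.
have s1 : (lam * rho) ^+ 2 < 1 by rewrite expr_lt1// mulr_ge0// ltW.
have s1' : 0 < 1 - (lam * rho) ^+ 2 by rewrite subr_gt0.
pose q := (Num.bound (1 - (lam * rho) ^+ 2)^-1).+2.
exists lam, rho, q; split => //; first by split; rewrite /rho; lra.
have q1 : (1 - (lam * rho) ^+ 2)^-1 <= q%:R.
  have p0 : 0 <= (1 - (lam * rho) ^+ 2)^-1 by rewrite invr_ge0 ltW.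
  apply: le_trans (ltW (archi_boundP p0)) _; rewrite ler_nat.
  exact: leqW (leqW (leqnn _)).
have q2 : 1 <= q%:R * (1 - (lam * rho) ^+ 2).
  by rewrite -ler_pdivrMr// mul1r.
have q3 : 1 <= q%:R :> R by rewrite (ler_nat _ 1).
have -> : (lam * rho) ^+ 2 * q%:R ^+ 2 =
  q%:R ^+ 2 - q%:R * (q%:R * (1 - (lam * rho) ^+ 2)) by ring.
by rewrite lerD2l lerN2 mulr_ege1.
Qed.

End choice_of_parameters.

Unset Implicit Arguments.

Theorem theorem2p2 (R : realType) (N : nat) (hN : N = 2%N \/ N = 3%N)
    (n sigma : R) (hn : 0 < n) (hsigma : 0 < sigma) (hnsigma : sigma < n ^+ 2)
    (tau : R) (htau0 : 0 < tau) (htau1 : tau < 1) :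
  exists (k : nat -> R) (u v : nat -> 'rV[R]_N -> R),
    [/\ forall m, transmission_eigenpair sigma n (k m) (u m) (v m),
      k m @[m --> \oo] --> +oo,
      (* the denominators of the two ratios below do not vanish *)
      forall m, 0 < fine (L2norm (eball 1) (u m)) /\
                0 < fine (L2norm (eball 1) (v m)),
      fine (L2norm (eball tau) (u m)) / fine (L2norm (eball 1) (u m))
        @[m --> \oo] --> 0 &
      fine (L2norm (eball tau) (v m)) / fine (L2norm (eball 1) (v m))
        @[m --> \oo] --> 0].
Proof.
have N1 : (1 < N)%N by case: hN => ->.
pose i0 : 'I_N := Ordinal (ltnW N1); pose i1 : 'I_N := Ordinal N1.
have i01 : i0 != i1 by [].
pose kappa := n / Num.sqrt sigma.
have ss0 : 0 < Num.sqrt sigma by rewrite sqrtr_gt0.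
have kappa0 : 0 < kappa by rewrite divr_gt0.
have kE : sigma * kappa ^+ 2 = n ^+ 2.
  by rewrite /kappa exprMn exprVn sqr_sqrtr ?ltW// mulrCA divff ?mulr1// gt_eqF.
have kappa1 : 1 < kappa.
  rewrite /kappa ltr_pdivlMr// mul1r -(@ltr_pXn2r _ 2)// ?nnegrE ?sqrtr_ge0 ?ltW//.
  by rewrite sqr_sqrtr// ltW.
have [lam [rho [q [l1 lk [taur rho1] q1 qE]]]] := exists_parameters kappa1 htau0 htau1.
have rho0 : 0 < rho by exact: lt_trans taur.
have [M0 _ rootM] := exists_transmission_root N1 l1 lk hsigma.
pose d m := (m + M0).+1; pose M m := ((q - 1) * d m + d m)%N.
have ME m : M m = (q * d m)%N by rewrite /M mulnBl mul1n subnK// leq_pmull// ltnW.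
have M0M m : (M0 <= M m)%N.
  by rewrite ME (leq_trans _ (leq_pmull _ (ltnW q1)))// /d leqW// leq_addl.
have Mgt0 m : (0 < M m)%N by rewrite ME muln_gt0 (ltnW q1).
have b0 m : (0 < (q - 1) * d m)%N by rewrite muln_gt0 subn_gt0 q1.
have /choice[K KP] := fun m => rootM (M m) (M0M m).
pose a m : R := order_of N (M m).
have MK m : (M m)%:R <= K m by have [/andP[]] := KP m.
have K0 m : 0 < K m by rewrite (lt_le_trans _ (MK m))// ltr0n.
pose k m := K m / kappa.
have kK m : k m <= K m by rewrite /k ler_pdivrMr// ler_peMr// ltW.
have k0 m : 0 < k m by rewrite divr_gt0.
have De m : sigma * bE N (M m) (K m) * bw (a m) (k m) = bw (a m) (K m) * bE N (M m) (k m).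
  by have [] := KP m.
have wK m : bw (a m) (K m) != 0 by have [] := KP m.
have wk m : bw (a m) (k m) != 0 by have [_ _ _ /lt0r_neq0] := KP m.
(* the ball of radius [rho] is below the turning point of both modes *)
have turning m (x : R) : 0 <= x -> x <= K m ->
    (x * rho) ^+ 2 <= ((q - 1) * d m)%:R * ((q - 1) * d m + 2 * d m)%:R.
  move=> x0 xK.
  have xM : x <= lam * (q%:R * (d m)%:R).
    by rewrite (le_trans xK)// -natrM -ME; have [/andP[]] := KP m.
  apply: (@le_trans _ _ ((lam * rho) ^+ 2 * q%:R ^+ 2 * (d m)%:R ^+ 2)).
    have h1 : 0 <= x * rho by rewrite mulr_ge0// ltW.
    have h2 : x * rho <= lam * (q%:R * (d m)%:R) * rho by rewrite ler_wpM2r// ltW.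
    have -> : (lam * rho) ^+ 2 * q%:R ^+ 2 * (d m)%:R ^+ 2 =
      (lam * (q%:R * (d m)%:R) * rho) ^+ 2 by ring.
    by rewrite lerXn2r// nnegrE// (le_trans h1).
  apply: le_trans (ler_wpM2r (sqr_ge0 _) qE) _.
  rewrite natrD !natrM natrB ?(ltnW q1)//.
  by rewrite le_eqVlt; apply/orP; left; apply/eqP; ring.
pose u m := mode i0 i1 (M m) (bw (a m) (k m)) (K m).
pose v m := mode i0 i1 (M m) (bw (a m) (K m)) (k m).
pose x0 : 'rV[R]_N := tau *: unit_vec i0.
have x0B : eball 1 x0.
  by rewrite eballE//= norm2_axis expr1n expr_lt1// ltW.
have mode_x0 m (alpha c : R) : 0 <= c -> c <= K m -> alpha != 0 ->
    mode i0 i1 (M m) alpha c x0 != 0.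
  move=> c0 cK al0; apply: mode_axis_neq0 => //.
  have crho : 0 <= c * tau <= c * rho.
    by rewrite (mulr_ge0 c0 (ltW htau0)) ler_wpM2l// ltW.
  by have [] := bw_growth N1 (b0 m) (mulr_ge0 c0 (ltW rho0)) (turning m c c0 cK) crho.
have ux0 m : u m x0 != 0 by apply: mode_x0 => //; exact: ltW.
have vx0 m : v m x0 != 0 by apply: mode_x0 => //; exact: ltW.
have Cu m : smooth (u m) by exact: smooth_mode.
have Cv m : smooth (v m) by exact: smooth_mode.
have u0 m := Rintegral_sqr_gt0 (smooth_continuous (Cu m)) x0B (ux0 m).
have v0 m := Rintegral_sqr_gt0 (smooth_continuous (Cv m)) x0B (vx0 m).
have [C C0 CP] := @radial_growth_concentration R N _ _ htau0 taur rho1.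
have conc m (alpha c : R) : 0 <= c -> c <= K m ->
    let w := mode i0 i1 (M m) alpha c in
    \int[lebesgue_rV]_(x in eball tau) w x ^+ 2 <=
    C / m.+1%:R * \int[lebesgue_rV]_(x in eball 1) w x ^+ 2.
  move=> c0 cK; rewrite /=; have d0 : 0 < (d m)%:R :> R by rewrite ltr0n.
  have grow := mode_growth N1 i0 i1 alpha (b0 m) c0 (ltW rho0) (turning m c c0 cK).
  apply: le_trans (CP _ _ d0 (smooth_mode N1 _ _ _ _ _) grow) _.
  rewrite ler_wpM2r ?Rintegral_ge0//; first by move=> x _; exact: sqr_ge0.
  rewrite ler_wpM2l// lef_pV2 ?posrE// ler_nat /d ltnS leq_addr //.
exists k, u, v; split.
- move=> m; apply: transmission_eigenpair_modes => //.
  exact: continuous_not_ae0 (smooth_continuous (Cu m)) x0B (ux0 m).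
- apply/cvgryPge => A; near=> m; rewrite /k ler_pdivlMr// (le_trans _ (MK m))//.
  apply: (@le_trans _ _ m%:R); first by near: m; exact: nbhs_infty_ger.
  by rewrite ler_nat ME (leq_trans _ (leq_pmull _ (ltnW q1)))// /d leqW// leq_addr.
- move=> m; rewrite !L2norm_continuous//; try exact: smooth_continuous.
  by rewrite /= !sqrtr_gt0; split; [exact: u0|exact: v0].
- by apply: (ratio_cvg0 htau0 htau1 Cu u0 (C := C)) => m; apply: conc => //; exact: ltW.
- by apply: (ratio_cvg0 htau0 htau1 Cv v0 (C := C)) => m; apply: conc => //; exact: ltW.
Unshelve. all: by end_near. Qed.
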